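(* For every $0<p<\infty$ there is a constant $C_p$, depending only on $p$, such that the following holds. Let $T>0$, let $(M_t)_{0\le t\le T}$ be a real-valued continuous local martingale, let $(V_t)_{0\le t\le T}$ be a non-positive adapted and continuous process, and set $$Z_t=e^{\int_0^tV_s\,ds}\int_0^te^{-\int_0^sV_u\,du}\,dM_s,\qquad 0\le t\le T.$$ Then $$\mathbb{E}\left(\Big(\sup_{0\le t\le T}|Z_t|\Big)^p\right)\le C_p\,\mathbb{E}\left(\langle M\rangle_T^{p/2}\right).$$ In particular $C_p$ is independent of $T$, $(M_t)$ and $(V_t)$.
   Context: All processes live on a complete filtered probability space satisfying the usual conditions; $\langle M\rangle$ denotes the quadratic variation process of $M$. *)

(* Defs.v *)
From HB Require Import structures.
From mathcomp Require Import all_boot all_order all_algebra.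
From mathcomp Require Import all_classical all_reals all_analysis.
Set Implicit Arguments.
Unset Strict Implicit.
Unset Printing Implicit Defensive.
Import Order.TTheory GRing.Theory Num.Theory.
Import numFieldNormedType.Exports.
Local Open Scope classical_set_scope.
Local Open Scope ring_scope.

Section StochasticProcesses.
Context {d : measure_display} {Omega : measurableType d} {R : realType}.

(* A real-valued process X on [0, T] is a function X : R -> Omega -> R; its
   values at times outside [0, T] are never used.  A filtration (F_t)_{t >= 0}
   is given by its family of sets of events; F t is irrelevant for t < 0. *)

Definition filtration (F : R -> set (set Omega)) : Prop :=
  [/\ forall t, 0 <= t -> sigma_algebra setT (F t),
      forall t, 0 <= t -> F t `<=` measurable &
      forall s t, 0 <= s -> s <= t -> F s `<=` F t].

Definition usual_conditions (P : probability Omega R)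
    (F : R -> set (set Omega)) : Prop :=
  [/\ measure_is_complete P,
      filtration F,
      forall t, 0 <= t -> F t = \bigcap_(s in [set s | t < s]) F s &
      forall N, P.-negligible N -> F 0 N].

Definition measurable_for (G : set (set Omega)) (X : Omega -> R) : Prop :=
  forall B : set R, measurable B -> G (X @^-1` B).

Definition adapted (F : R -> set (set Omega)) (T : R) (X : R -> Omega -> R) :
    Prop :=
  forall t, 0 <= t <= T -> measurable_for (F t) (X t).

Definition continuous_process (T : R) (X : R -> Omega -> R) : Prop :=
  forall w, {within `[0, T], continuous (fun t => X t w)}.

(* Y is a version of the conditional expectation E[X | G]. *)
Definition is_cond_exp (P : probability Omega R) (G : set (set Omega))
    (X Y : Omega -> R) : Prop :=
  [/\ measurable_for G Y,
      P.-integrable setT (EFin \o Y) &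
      forall A, G A ->
        (\int[P]_(w in A) (Y w)%:E = \int[P]_(w in A) (X w)%:E)%E].

Definition martingale (P : probability Omega R) (F : R -> set (set Omega))
    (T : R) (X : R -> Omega -> R) : Prop :=
  [/\ adapted F T X,
      forall t, 0 <= t <= T -> P.-integrable setT (EFin \o X t) &
      forall s t, 0 <= s -> s <= t -> t <= T ->
        is_cond_exp P (F s) (X t) (X s)].

(* On the bounded time interval [0, T] finite stopping times suffice. *)
Definition stopping_time (F : R -> set (set Omega)) (tau : Omega -> R) : Prop :=
  (forall w, 0 <= tau w) /\
  (forall t, 0 <= t -> F t [set w | tau w <= t]).

(* The sigma-algebra F_tau of events prior to tau. *)
Definition stopped_sigma (F : R -> set (set Omega)) (tau : Omega -> R) :
    set (set Omega) :=
  [set A | measurable A /\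
           forall t, 0 <= t -> F t (A `&` [set w | tau w <= t])].

Definition stopped (tau : Omega -> R) (X : R -> Omega -> R) :
    R -> Omega -> R :=
  fun t w => X (Num.min t (tau w)) w.

(* The initial value is subtracted before localizing, so that X 0 need not be
   integrable.  On the closed interval [0, T], "tau_n increases to infinity"
   reads: almost surely, tau_n is nondecreasing and eventually at least T. *)
Definition local_martingale (P : probability Omega R)
    (F : R -> set (set Omega)) (T : R) (X : R -> Omega -> R) : Prop :=
  adapted F T X /\
  exists tau : nat -> Omega -> R,
    [/\ forall n, stopping_time F (tau n),
        {ae P, forall w, nondecreasing_seq (fun n => tau n w) /\
                         exists n, T <= tau n w} &
        forall n, martingale P F T (fun t w => stopped (tau n) X t w - X 0 w)].

Definition continuous_local_martingale (P : probability Omega R)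
    (F : R -> set (set Omega)) (T : R) (M : R -> Omega -> R) : Prop :=
  local_martingale P F T M /\ continuous_process T M.

(* Q is (a version of) <M>: the continuous adapted nondecreasing process,
   unique up to indistinguishability, that starts at 0 and makes M^2 - <M> a
   local martingale. *)
Definition is_quadratic_variation (P : probability Omega R)
    (F : R -> set (set Omega)) (T : R) (M Q : R -> Omega -> R) : Prop :=
  [/\ adapted F T Q,
      continuous_process T Q,
      forall w, Q 0 w = 0,
      forall w s t, 0 <= s -> s <= t -> t <= T -> Q s w <= Q t w &
      local_martingale P F T (fun t w => M t w ^+ 2 - Q t w)].

Definition running_sup (T : R) (X : R -> Omega -> R) (w : Omega) : \bar R :=
  ereal_sup [set (`|X t w|)%:E | t in `[0, T]].

(* Convergence uniformly on [0, T], in probability. *)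
Definition ucp_cvg (P : probability Omega R) (T : R)
    (X : nat -> R -> Omega -> R) (Y : R -> Omega -> R) : Prop :=
  forall eps : R, 0 < eps ->
    (fun n => P [set w : Omega |
       (eps%:E < running_sup T (fun t w => (X n t w - Y t w)%R) w)%E]) @ \oo --> 0%E.

(* The simple process
     coef0 1_{0} + \sum_(i < size) coef i 1_{]time i, time i.+1]}. *)
Record simple_process := SimpleProcess {
  sp_size : nat;
  sp_coef0 : Omega -> R;
  sp_time : nat -> Omega -> R;
  sp_coef : nat -> Omega -> R }.

Definition simple_predictable (F : R -> set (set Omega))
    (S : simple_process) : Prop :=
  [/\ measurable_for (F 0) (sp_coef0 S),
      forall i, (i <= sp_size S)%N -> stopping_time F (sp_time S i),
      forall i w, (i < sp_size S)%N -> sp_time S i w <= sp_time S i.+1 w &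
      forall i, (i < sp_size S)%N ->
        measurable_for (stopped_sigma F (sp_time S i)) (sp_coef S i)].

Definition simple_value (S : simple_process) (t : R) (w : Omega) : R :=
  sp_coef0 S w * (t == 0)%R%:R +
  \sum_(i < sp_size S)
     sp_coef S i w * (sp_time S i w < t <= sp_time S i.+1 w)%R%:R.

(* The integral over ]0, t]: the coefficient at time 0 does not contribute. *)
Definition simple_integral (S : simple_process) (M : R -> Omega -> R)
    (t : R) (w : Omega) : R :=
  \sum_(i < sp_size S)
     sp_coef S i w *
     (stopped (sp_time S i.+1) M t w - stopped (sp_time S i) M t w).

(* I is (a version of) the Ito integral \int_0^. H dM of the continuous
   adapted process H against the continuous local martingale M, as the ucp
   continuous extension of the elementary integral of simple predictable
   processes (Protter, Stochastic Integration and Differential Equations,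
   II.4). *)
Definition is_stochastic_integral (P : probability Omega R)
    (F : R -> set (set Omega)) (T : R) (M H I : R -> Omega -> R) : Prop :=
  [/\ adapted F T I,
      continuous_process T I &
      forall S : nat -> simple_process,
        (forall n, simple_predictable F (S n)) ->
        ucp_cvg P T (fun n => simple_value (S n)) H ->
        ucp_cvg P T (fun n => simple_integral (S n) M) I].

(* \int_0^t V_s ds, pathwise. *)
Definition time_integral (V : R -> Omega -> R) (t : R) (w : Omega) : R :=
  \int[@lebesgue_measure R]_(s in `[0, t]) V s w.

End StochasticProcesses.

(* Main.v *)
Require Import Defs.
From HB Require Import structures.
From mathcomp Require Import all_boot all_order all_algebra.
From mathcomp Require Import all_classical all_reals all_analysis.
From mathcomp Require Import measurable_realfun ring lra.
Set Implicit Arguments.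
Unset Strict Implicit.
Unset Printing Implicit Defensive.
Import Order.TTheory GRing.Theory Num.Theory.
Import numFieldNormedType.Exports.
Local Open Scope classical_set_scope.
Local Open Scope ring_scope.

(* Put N = M - M_0, A_t = - \int_0^t V_s ds and S = sup |N|.

   Since A is nondecreasing, Z is controlled by N pathwise: summation by parts
   bounds the Riemann sums \sum e^{A_{t_i}} (N_{t_{i+1}} - N_{t_i}) up to time t
   by 2 e^{A_t} S, and this passes to the ucp limit, so |Z| <= 2 S almost surely.

   It remains to bound E S^p by C_p E <M>_T^{p/2}, for all p > 0 at once, with
   Burkholder's good-lambda inequality
     P(S >= 2 l, <M>_T < D l^2) <= 2 D P(S >= l).
   Stop N at the level l (time a) and at the level 2 l or when <M> reaches D l^2
   (time b): the increment N_b - N_a has second moment at most D l^2 P(S >= l),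
   because M^2 - <M> is a local martingale, and it is at least l on the event of
   the left-hand side.  Taking l = e 2^i and D = 2^{-p-2}, the weighted sums
   \sum_i l_i^p P(S >= l_i), comparable to E S^p, satisfy a recursion that
   contracts by 1/2. *)

(** The bracket enters only through its monotonicity and the local martingale X = M^2 - <M>. The
    obstacle is the initial value: X - X_0 = N^2 + 2 M_0 N - <M>, and M_0 is an arbitrary
    F_0-measurable variable, so 2 M_0 N cannot be integrated as it stands. Hence the second-moment
    estimate is made on cells of F_0 where M_0 is within e of a constant c: there 2 c N has
    increments of mean zero, the rest is of order e, and e tends to 0 after summation over the
    cells.

    The good-lambda inequality is first proved for N and for -N separately, because the argument
    needs N at time a to be one fixed number; this is the source of the factor 2 in 2 D.

    No moment of S is known to be finite beforehand. The weighted sums are therefore cut at finitely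
    many levels, where half of the sum can be absorbed, and the cut is removed by monotone
    convergence.

    On the pathwise side the stochastic integral is tested on a single sequence of integrands, the
    left-endpoint steps of exp(A) on a uniform grid. *)

Lemma measurable_forP {d : measure_display} {Omega : measurableType d}
    {R : realType} (G : set (set Omega)) (X : Omega -> R) :
  sigma_algebra setT G ->
  measurable_for G X <->
  measurable_fun [set: g_sigma_algebraType G] (X : g_sigma_algebraType G -> R).
Proof.
move=> sG; split=> [GX _ B mB|GX B mB].
  by rewrite setTI measurable_g_measurableTypeE//; exact: GX.
by have := GX measurableT B mB; rewrite setTI measurable_g_measurableTypeE.
Qed.

(** * Clamped times and uniform time grids *)

Definition clamp {R : realType} (t s : R) : R := Num.max 0 (Num.min t s).

Section clamp.
Context {R : realType}.
Implicit Types t s : R.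

Lemma clamp_itv t s : 0 <= t -> 0 <= clamp t s <= t.
Proof. by move=> t0; rewrite /clamp le_max lexx /= ge_max t0 ge_min lexx. Qed.

Lemma clamp_id t s : 0 <= s <= t -> clamp t s = s.
Proof. by move=> /andP[s0 st]; rewrite /clamp (min_r st) max_r. Qed.

Lemma clamp_min t s : 0 <= t -> 0 <= s -> clamp t s = Num.min t s.
Proof. by move=> t0 s0; rewrite /clamp max_r// le_min t0. Qed.

Lemma continuous_clamp t : continuous (clamp t).
Proof.
move=> s; apply: continuous_max; first exact: cst_continuous.
by apply: continuous_min; [exact: cst_continuous|exact: cvg_id].
Qed.

(** Paths are continuous only within [0, t]; after clamping the time they become continuous on the
    whole line, where ordinary limits can be composed. *)
Lemma continuous_comp_clamp (f : R -> R) t : 0 <= t ->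
  {within `[0, t], continuous f} -> continuous (f \o clamp t).
Proof.
move=> t0 /subspace_continuousP cf s.
have cs : `[0, t]%classic (clamp t s) by rewrite /= in_itv /= clamp_itv.
apply: (cvg_trans _ (cf _ cs)) => U /= nU.
have nfU : \forall x \near s, `[0, t]%classic (clamp t x) -> U (f (clamp t x)).
  exact: (@continuous_clamp t s _ nU).
have UE : \forall x \near s, U (f (clamp t x)).
  apply: filterS nfU => x; apply.
  by rewrite /= in_itv /= clamp_itv.
exact: UE.
Qed.

End clamp.

Section grid.
Context {R : realType}.
Implicit Types (s t : R) (k j : nat).

Definition gridpt k j : R := j%:R / k.+1%:R.

(* For s >= 0, the least j such that s <= gridpt k j; meaningless for s < 0. *)
Definition gridindex k s : nat := `|Num.ceil (s * k.+1%:R)|%N.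

Lemma gridpt_ge0 k j : 0 <= gridpt k j.
Proof. by rewrite /gridpt divr_ge0. Qed.

Lemma gridpt0 k : gridpt k 0 = 0.
Proof. by rewrite /gridpt mul0r. Qed.

Lemma gridptS k j : gridpt k j.+1 = gridpt k j + k.+1%:R^-1.
Proof. by rewrite /gridpt -natr1 mulrDl mul1r. Qed.

Lemma le_gridpt k i j : (i <= j)%N -> gridpt k i <= gridpt k j.
Proof. by move=> ij; rewrite /gridpt ler_pM2r// ler_nat. Qed.

(** This adjunction is the source of the other facts about [gridindex], and it turns conditions on
    the index into conditions on the time. *)
Lemma gridindex_le k s j : 0 <= s -> (gridindex k s <= j)%N = (s <= gridpt k j).
Proof.
move=> s0; have c0 : (0 <= Num.ceil (s * k.+1%:R))%R.
  by rewrite ceil_ge0// (lt_le_trans (ltrN10 _))// mulr_ge0.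
rewrite /gridindex /gridpt ler_pdivlMr// -lez_nat gez0_abs//.
by rewrite ceil_le_int.
Qed.

Lemma gridindex_ge k s : 0 <= s -> s <= gridpt k (gridindex k s).
Proof. by move=> s0; rewrite -gridindex_le. Qed.

Lemma gridindex_ub k s : 0 <= s ->
  gridpt k (gridindex k s) <= s + k.+1%:R^-1.
Proof.
move=> s0; case E : (gridindex k s) => [|j].
  by rewrite gridpt0 addr_ge0.
rewrite gridptS lerD2r leNgt; apply/negP => /ltW.
by rewrite -gridindex_le// E ltnn.
Qed.

Lemma gridpt_cvg s : 0 <= s -> gridpt k (gridindex k s) @[k --> \oo] --> s.
Proof.
move=> s0; apply: (@squeeze_cvgr _ _ _ _ (cst s) (fun k => s + k.+1%:R^-1)).
- by near=> k; rewrite gridindex_ge// gridindex_ub.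
- exact: cvg_cst.
- rewrite -[X in _ --> X]addr0; apply: cvgD; first exact: cvg_cst.
  exact: cvg_harmonic.
Unshelve. all: by end_near. Qed.

End grid.

(** * Stopping times of continuous processes *)

Section progressive.
Context {d : measure_display} {Omega : measurableType d} {R : realType}.
Variables (F : R -> set (set Omega)) (T : R).
Hypothesis FF : filtration F.

(** [Y] at time s is the limit of [Y] at the grid time just above s. Each approximation is constant
    in s on countably many cells, and clamping the grid time to [0, t] keeps it [F t]-measurable. *)
Lemma progressively_measurable (Y : R -> Omega -> R) (t : R) :
  0 <= t <= T -> adapted F T Y -> continuous_process T Y ->
  measurable_fun [set: g_sigma_algebraType (F t) * R]
    (fun z : g_sigma_algebraType (F t) * R => Y (clamp t z.2) z.1).
Proof.
move=> /andP[t0 tT] aY cY; have [sF _ incF] := FF.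
pose ix k (s : R) := gridindex k (Num.max 0 s).
apply: (@measurable_fun_cvg _ _ _ _ (fun k (z : g_sigma_algebraType (F t) * R) =>
  Y (clamp t (gridpt k (ix k z.2))) z.1)); last first.
  move=> [w s] _ /=.
  have := @gridpt_cvg R (Num.max 0 s); rewrite le_max lexx => /(_ isT) gs.
  have T0 : 0 <= T by exact: le_trans tT.
  have cYt : {within `[0, t], continuous (fun t => Y t w)}.
    by apply: continuous_subspaceW (cY w); apply: subset_itvl; rewrite bnd_simp.
  have -> : Y (clamp t s) w = Y (clamp t (Num.max 0 s)) w.
    congr (Y _ w); rewrite /clamp; have [//|s0] := leP 0 s.
    by rewrite (min_r t0) (min_r (le_trans (ltW s0) t0)) maxxx max_l// ltW.
  have cYs := @continuous_comp_clamp _ (fun t => Y t w) t t0 cYt (Num.max 0 s).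
  apply: (cvg_comp _ _ gs cYs).
move=> k _ B mB; rewrite setTI.
rewrite (_ : _ @^-1` B = \bigcup_j ((Y (clamp t (gridpt k j)) @^-1` B) `*`
   [set s | ix k s = j])); last first.
  apply/seteqP; split => [[w s] /= YB|[w s] [j _ /= [YB ixj]]]; last by rewrite ixj.
  by exists (ix k s).
apply: bigcup_measurable => j _; apply: measurableX.
  have := clamp_itv (gridpt k j) t0; move: (clamp _ _) => u /andP[u0 ut].
  rewrite measurable_g_measurableTypeE; last exact: sF.
  by apply: (incF u t) => //; apply: aY => //; rewrite u0 (le_trans ut).
have mle i : measurable [set s : R | (ix k s <= i)%N].
  rewrite (_ : mkset _ = `]-oo, gridpt k i]%classic); first exact: measurable_itv.
  apply/seteqP; split => s /=; rewrite in_itv /= /ix gridindex_le ?le_max ?lexx//.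
    by rewrite ge_max => /andP[].
  by rewrite ge_max gridpt_ge0.
case: j => [|j].
  rewrite (_ : mkset _ = [set s | (ix k s <= 0)%N])//.
  by apply/seteqP; split => s /=; rewrite leqn0 => /eqP.
rewrite (_ : mkset _ = [set s | (ix k s <= j.+1)%N] `\` [set s | (ix k s <= j)%N]).
  exact: measurableD.
apply/seteqP; split => [s /= ->|s /= [h1 /negP]]; first by rewrite leqnn ltnn.
by rewrite -ltnNge => h2; apply/eqP; rewrite eqn_leq h1.
Qed.

(** The stopped value is the jointly measurable map of [progressively_measurable] composed with w ->
    (w, min(t, a w)); the second component is determined by the events {a <= u} with u <= t. *)
Lemma measurable_at_stopping (Y : R -> Omega -> R) (a : Omega -> R) (t : R) :
  0 <= t <= T -> adapted F T Y -> continuous_process T Y ->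
  (forall w, 0 <= a w) ->
  (forall u, 0 <= u <= t -> F t [set w | a w <= u]) ->
  measurable_for (F t) (fun w => Y (Num.min t (a w)) w).
Proof.
move=> t0T aY cY a0 Fa; have [sF _ _] := FF; have /andP[t0 tT] := t0T.
apply/measurable_forP; first exact: sF.
rewrite (_ : (fun w => _) = (fun z : g_sigma_algebraType (F t) * R =>
    Y (clamp t z.2) z.1) \o (fun w => (w, Num.min t (a w)))); last first.
  by apply/funext => w /=; rewrite clamp_id// le_min t0 a0/= ge_min lexx.
apply: measurableT_comp; first exact: progressively_measurable.
apply: measurable_fun_pair => //.
apply: (measurability _ (RGenOInfty.measurableE R)) => //=.
move=> _ [_ [x ->] <-]; rewrite setTI measurable_g_measurableTypeE; last exact: sF.
have [F0 FC _] := sF _ t0.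
have [tx|xt] := leP t x.
  rewrite (_ : _ @^-1` _ = set0)//; apply/seteqP; split => // w /=.
  by rewrite in_itv /= andbT lt_min ltNge tx.
have [x0|x0] := ltP x 0.
  rewrite (_ : _ @^-1` _ = setT `\` set0); first exact: FC.
  rewrite setD0; apply/seteqP; split => // w _ /=.
  by rewrite in_itv /= andbT lt_min xt (lt_le_trans x0).
rewrite (_ : _ @^-1` _ = setT `\` [set w | a w <= x]).
  by apply/FC/Fa; rewrite x0 ltW.
apply/seteqP; split => w /=; rewrite in_itv /= andbT lt_min xt /= ltNge.
  by move=> /negP.
by move=> [_ /negP].
Qed.

End progressive.

Section running_level.
Context {d : measure_display} {Omega : measurableType d} {R : realType}.
Variables (F : R -> set (set Omega)) (T : R).
Hypothesis FF : filtration F.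

(** By compactness the level is reached as soon as it is approached arbitrarily closely, and by
    continuity grid times detect the approach. The margin 1/(n+1) allows for a maximum attained off
    the grid. The right-hand side is a countable condition, hence observable at time t. *)
Lemma exists_geP (f : R -> R) (t l : R) : 0 <= t ->
  {within `[0, t], continuous f} ->
  (exists s, 0 <= s <= t /\ l <= f s) <->
  (forall n, exists k j, l - n.+1%:R^-1 < f (clamp t (gridpt k j))).
Proof.
move=> t0 cf; split=> [[s [st ls]] n|H].
  have /andP[s0 _] := st.
  have cfs := @continuous_comp_clamp _ f t t0 cf s.
  have : f (clamp t (gridpt k (gridindex k s))) @[k --> \oo] --> f (clamp t s).
    by apply: (cvg_comp _ _ (gridpt_cvg s0) cfs).
  rewrite clamp_id// => /cvgrPdist_lt /(_ n.+1%:R^-1).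
  rewrite invr_gt0 ltr0n => /(_ isT) [k _ /(_ k (leqnn k))] /=.
  move=> /ltr_distlBl H; exists k, (gridindex k s).
  by apply: le_lt_trans H; rewrite lerD2r.
have [c] := EVT_max t0 cf; rewrite in_itv /= => ct cmax.
exists c; split => //; rewrite leNgt; apply/negP; rewrite -subr_gt0 => lc.
have [n] := ltr_add_invr lc; rewrite add0r => nlc.
have [k [j]] := H n; apply/negP; rewrite -leNgt.
apply: (@le_trans _ _ (f c)); first by apply: cmax; rewrite in_itv /= clamp_itv.
by rewrite lerBrDr -lerBrDl ltW.
Qed.

Lemma measurable_exists_ge (Y : R -> Omega -> R) (t l : R) : 0 <= t <= T ->
  adapted F T Y -> continuous_process T Y ->
  F t [set w | exists s, 0 <= s <= t /\ l <= Y s w].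
Proof.
move=> /andP[t0 tT] aY cY; have [sF _ incF] := FF.
rewrite (_ : mkset _ = \bigcap_n \bigcup_k \bigcup_j
    [set w | l - n.+1%:R^-1 < Y (clamp t (gridpt k j)) w]).
  rewrite -(measurable_g_measurableTypeE (sF _ t0)).
  apply: bigcapT_measurable => n; apply: bigcupT_measurable => k.
  apply: bigcupT_measurable => j.
  rewrite measurable_g_measurableTypeE; last exact: sF.
  have := clamp_itv (gridpt k j) t0; move: (clamp _ _) => u /andP[u0 ut].
  apply: (incF u t) => //.
  have := aY u _ `]l - n.+1%:R^-1, +oo[%classic (measurable_itv _).
  rewrite u0 (le_trans ut)// => /(_ isT).
  by congr (F u _); apply/seteqP; split => w /=; rewrite in_itv /= andbT.
have cYt w : {within `[0, t], continuous (fun t => Y t w)}.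
  by apply: continuous_subspaceW (cY w); apply: subset_itvl; rewrite bnd_simp.
apply/seteqP; split => w /=.
  move/(exists_geP _ t0 (cYt w)) => H n _; have [k [j ?]] := H n.
  by exists k => //; exists j.
move=> H; apply/(exists_geP _ t0 (cYt w)) => n.
by have [k _ [j _ ?]] := H n Logic.I; exists k, j.
Qed.

End running_level.

Section hitting.
Context {d : measure_display} {Omega : measurableType d} {R : realType}.
Variables (F : R -> set (set Omega)) (T : R).

(** Processes are adapted on [0, T] only, so times take values in [0, T] and are tested at times of
    [0, T]. *)
Definition stopping_upto (a : Omega -> R) : Prop :=
  (forall w, 0 <= a w <= T) /\
  (forall t, 0 <= t <= T -> F t [set w | a w <= t]).

(* The value is T when the level l is not reached on [0, T]. *)
Definition hitting (Y : R -> Omega -> R) (l : R) (w : Omega) : R :=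
  inf [set t | 0 <= t <= T /\ (l <= Y t w \/ t = T)].

Hypotheses (FF : filtration F) (T0 : 0 <= T).
Variables (Y : R -> Omega -> R) (l : R).
Hypothesis cY : continuous_process T Y.

Let hset w := [set t | 0 <= t <= T /\ (l <= Y t w \/ t = T)].

Let hset_inf w : has_inf (hset w).
Proof.
split; first by exists T; split; [rewrite T0 lexx|right].
by exists 0 => t [/andP[]].
Qed.

Lemma hitting_le t w : 0 <= t <= T -> l <= Y t w -> hitting Y l w <= t.
Proof.
by move=> tT lY; apply: ge_inf; [exact: (hset_inf w).2|split; [|left]].
Qed.

Lemma hitting_itv w : 0 <= hitting Y l w <= T.
Proof.
apply/andP; split.
  by apply: lb_le_inf; [exact: (hset_inf w).1|move=> t [/andP[]]].
by apply: ge_inf; [exact: (hset_inf w).2|split; [rewrite T0 lexx|right]].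
Qed.

Lemma lt_hitting t w : 0 <= t -> t < hitting Y l w -> Y t w < l.
Proof.
move=> t0 th; rewrite ltNge; apply/negP => /hitting_le H.
have /andP[_ hT] := hitting_itv w.
by move: (th); rewrite ltNge H// t0 (le_trans (ltW th)).
Qed.

(** The infimum is attained by continuity: if [Y] were below [l] there, it would stay below on a
    right neighbourhood, in which the defining set must have points. The hypothesis excludes paths
    for which the infimum is merely the default value T. *)
Lemma hitting_ge w : (exists t, 0 <= t <= T /\ l <= Y t w) ->
  l <= Y (hitting Y l w) w.
Proof.
move=> [t [tT lY]]; rewrite leNgt; apply/negP => Yl.
have hT := hitting_itv w.
have cfs := @continuous_comp_clamp _ (fun t => Y t w) T T0 (cY (w := w)) (hitting Y l w).
have /cvgrPdist_lt /(_ (l - Y (hitting Y l w) w)) :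
  Y (clamp T x) w @[x --> hitting Y l w] --> Y (clamp T (hitting Y l w)) w by exact: cfs.
rewrite subr_gt0 clamp_id// => /(_ Yl) [e /= e0 He].
have hlt : hitting Y l w < t.
  rewrite lt_neqAle hitting_le// andbT; apply: contraTneq lY => <-.
  by rewrite -ltNge.
have [s sS sh] : exists2 s, hset w s & s < Num.min t (hitting Y l w + e).
  by apply: inf_lt; [exact: (hset_inf w).1|rewrite lt_min hlt ltrDl].
have hs : hitting Y l w <= s by apply: ge_inf => //; exact: (hset_inf w).2.
case: sS => sT; move: sh; rewrite lt_min => /andP[st she] [lYs|sTE]; last first.
  by move: tT st; rewrite sTE => /andP[_ tT]; rewrite ltNge tT.
have /= := He s; rewrite ler0_norm ?subr_le0// opprB ltrBlDl => /(_ she).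
rewrite clamp_id// => /ltr_distlCDr; rewrite subrKC.
by rewrite ltNge lYs.
Qed.

(** At the hitting time the value is a limit from the left of values below [l]. The hypothesis on
    [Y 0 w] covers a hitting time equal to 0, which has no left neighbourhood. *)
Lemma le_hitting t w : Y 0 w <= l -> 0 <= t -> t <= hitting Y l w -> Y t w <= l.
Proof.
move=> Y0l t0; rewrite le_eqVlt => /predU1P[->|th]; last exact/ltW/lt_hitting.
have [h0|h0] := eqVneq (hitting Y l w) 0; first by rewrite h0.
have hT := hitting_itv w; have /andP[h_ge0 _] := hT.
have {}h0 : 0 < hitting Y l w by rewrite lt_neqAle eq_sym h0.
rewrite leNgt; apply/negP => lY.
have cfs := @continuous_comp_clamp _ (fun t => Y t w) T T0 (cY (w := w)) (hitting Y l w).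
have /cvgrPdist_lt /(_ (Y (hitting Y l w) w - l)) :
  Y (clamp T x) w @[x --> hitting Y l w] --> Y (clamp T (hitting Y l w)) w by exact: cfs.
rewrite subr_gt0 clamp_id// => /(_ lY) [e /= e0 He].
pose s := Num.max 0 (hitting Y l w - e / 2).
have s0 : 0 <= s by rewrite le_max lexx.
have sh : s < hitting Y l w by rewrite gt_max h0 ltrBlDr ltrDl divr_gt0.
have /= := He s; rewrite ger0_norm ?subr_ge0 1?ltW//.
have -> : hitting Y l w - s < e.
  by rewrite ltrBlDr -ltrBlDl lt_max ltrD2l ltrN2 [X in _ || X]gtr_pMr// orbC
     invf_lt1// ltr1n.
move=> /(_ isT); rewrite clamp_id; last first.
  by rewrite s0 (le_trans (ltW sh))//; case/andP: hT.
move=> /ltr_distlBl; rewrite opprB addrC subrK.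
by rewrite ltNge (ltW (lt_hitting s0 sh)).
Qed.

Lemma hitting_stopping : adapted F T Y -> stopping_upto (hitting Y l).
Proof.
move=> aY; split; first exact: hitting_itv.
(* Because of the default value T, the event is the whole space at t = T; for t < T it says that the
   level has really been reached by time t. *)
move=> t /andP[t0]; rewrite le_eqVlt => /predU1P[->|tT].
  rewrite (_ : mkset _ = setT `\` set0).
    by have [sF _ _] := FF; have [F0 FC _] := sF _ T0; exact: FC.
  by rewrite setD0; apply/seteqP; split => // w _; have /andP[] := hitting_itv w.
rewrite (_ : mkset _ = [set w | exists s, 0 <= s <= t /\ l <= Y s w]).
  by apply: (measurable_exists_ge FF (T := T)) => //; rewrite t0 ltW.
apply/seteqP; split => w /=; last first.
  move=> [s [/andP[s0 st] lY]]; apply: le_trans (st); apply: hitting_le => //.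
  by rewrite s0 (le_trans st)// ltW.
move=> ht; exists (hitting Y l w); have /andP[h0 _] := hitting_itv w.
split; first by rewrite h0.
apply: hitting_ge; apply: contrapT => noY.
have : T <= hitting Y l w.
  apply: lb_le_inf => [|s [sT [lY|->//]]]; first exact: (hset_inf w).1.
  by case: noY; exists s.
by rewrite leNgt (le_lt_trans ht).
Qed.

End hitting.

Lemma stopping_upto_min {d : measure_display} {Omega : measurableType d}
    {R : realType} (F : R -> set (set Omega)) (T : R) (a b : Omega -> R) :
  filtration F -> stopping_upto F T a -> stopping_upto F T b ->
  stopping_upto F T (fun w => Num.min (a w) (b w)).
Proof.
move=> [sF _ _] [aT Fa] [bT Fb]; split=> [w|t tT].
  have /andP[a0 aT'] := aT w; have /andP[b0 _] := bT w.
  by rewrite le_min a0 b0 ge_min aT'.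
have /andP[t0 _] := tT.
rewrite (_ : mkset _ = [set w | a w <= t] `|` [set w | b w <= t]).
  rewrite -(measurable_g_measurableTypeE (sF _ t0)).
  by apply: measurableU; rewrite measurable_g_measurableTypeE; auto.
by apply/seteqP; split => w /=; rewrite ge_min => /orP.
Qed.

(** * Optional stopping *)

Section optional_stopping.
Context {d : measure_display} {Omega : measurableType d} {R : realType}.
Variables (P : probability Omega R) (F : R -> set (set Omega)) (T : R).
Hypotheses (FF : filtration F) (T0 : 0 <= T).

(* A belongs to F_a. *)
Definition prior (a : Omega -> R) (A : set Omega) : Prop :=
  forall t, 0 <= t <= T -> F t (A `&` [set w | a w <= t]).

Lemma integral_EFin_indic (A : set Omega) (f : Omega -> R) :
  (\int[P]_(w in A) (f w)%:E = \int[P]_w (f w * \1_A w)%:E)%E.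
Proof. by rewrite integral_mkcond epatch_indic; apply: eq_integral. Qed.

Lemma dominated_cvg_EFin (f : nat -> Omega -> R) (f_ g : Omega -> R) :
  (forall n, measurable_fun setT (f n)) -> measurable_fun setT f_ ->
  {ae P, forall w, f n w @[n --> \oo] --> f_ w} ->
  P.-integrable setT (EFin \o g) -> (forall n w, `|f n w| <= g w) ->
  (\int[P]_w (f n w)%:E)%E @[n --> \oo] --> (\int[P]_w (f_ w)%:E)%E.
Proof.
move=> mf mf_ ff_ ig fg.
have [] := @dominated_convergence _ _ _ P _ measurableT
  (fun n => EFin \o f n) (EFin \o f_) (EFin \o g) => //.
- by move=> n; apply/measurable_EFinP.
- exact/measurable_EFinP.
- by apply: filterS ff_ => w fw _; apply: cvg_EFin => //; apply: nearW.
- by apply: aeW => w n _; rewrite lee_fin.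
Qed.

Lemma measurable_for_fun (t : R) (X : Omega -> R) : 0 <= t ->
  measurable_for (F t) X -> measurable_fun setT X.
Proof. by have [_ mF _] := FF => t0 mX _ B mB; rewrite setTI; apply/(mF t)/mX. Qed.

Lemma bounded_fun_integrable (A : set Omega) (X : Omega -> R) (K : R) :
  measurable A -> measurable_fun setT X -> (forall w, A w -> `|X w| <= K) ->
  P.-integrable A (EFin \o X).
Proof.
move=> mA mX XK; apply: measurable_bounded_integrable => //.
- by rewrite (le_lt_trans (probability_le1 P mA))// ltry.
- exact: measurable_funTS.
- by exists K; split; [exact: num_real|] => x Kx w Aw /=; rewrite (le_trans (XK _ Aw))// ltW.
Qed.

Lemma prior_measurable (a : Omega -> R) (A : set Omega) :
  stopping_upto F T a -> prior a A -> measurable A.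
Proof.
move=> [aT _] /(_ T); rewrite T0 lexx => /(_ isT); have [_ mF _] := FF.
rewrite (_ : [set w | a w <= T] = setT) ?setIT => [/mF|]; first exact.
by apply/seteqP; split => // w _ /=; have /andP[] := aT w.
Qed.

Lemma measurable_stopped (Y : R -> Omega -> R) (a : Omega -> R) :
  adapted F T Y -> continuous_process T Y -> stopping_upto F T a ->
  measurable_fun setT (fun w => Y (a w) w).
Proof.
move=> aY cY [aT Fa]; rewrite (_ : (fun w => _) = fun w => Y (Num.min T (a w)) w).
  apply: (measurable_for_fun T0).
  apply: (measurable_at_stopping FF _ aY cY) => //; first by rewrite T0 lexx.
    by move=> w; have /andP[] := aT w.
  move=> u uT; have /andP[u0 uT'] := uT; have [_ _ incF] := FF.
  exact: (incF u T u0 uT' _ (Fa u uT)).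
by apply/funext => w; have /andP[_ aT'] := aT w; rewrite min_r.
Qed.

(* With a_k the grid approximation of a from above, discrete optional sampling
   gives \int_B Y_{a_k} = \int_B Y_T for B = A `&` {|Y_{a_k}| <= K + 1}.  These
   events increase to A in the limit since |Y_a| <= K, so that both sides
   converge by domination and no uniform integrability is needed. *)
Lemma optional_stopping (Y : R -> Omega -> R) (a : Omega -> R) (A : set Omega)
    (K : R) :
  martingale P F T Y -> continuous_process T Y -> stopping_upto F T a ->
  (forall w, `|Y (a w) w| <= K) -> prior a A ->
  (\int[P]_(w in A) (Y (a w) w)%:E = \int[P]_(w in A) (Y T w)%:E)%E.
Proof.
move=> [aY iY mY] cY sa YK pA; have [sF mF incF] := FF; have [aT Fa] := sa.
have mA := prior_measurable sa pA.
have a0 w : 0 <= a w by have /andP[] := aT w.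
pose g n j := clamp T (gridpt n j).
have gT n j : 0 <= g n j <= T by exact: clamp_itv.
have g0 n j : 0 <= g n j by have /andP[] := gT n j.
pose ix n w := gridindex n (a w).
pose E (A' : set Omega) n j := A' `&` [set w | ix n w = j].
pose Yn n w := Y (g n (ix n w)) w.
have FC t (B C : set Omega) : 0 <= t -> F t B -> F t C -> F t (B `\` C).
  move=> t0; rewrite -(measurable_g_measurableTypeE (sF _ t0)).
  exact: measurableD.
have FI t (B C : set Omega) : 0 <= t -> F t B -> F t C -> F t (B `&` C).
  move=> t0; rewrite -(measurable_g_measurableTypeE (sF _ t0)).
  exact: measurableI.
(* Approximating from above matters here: whether [a] lies at or below the grid time [g n j] is
   known at that time. *)
have le_g A' n j : prior a A' -> F (g n j) (A' `&` [set w | (ix n w <= j)%N]).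
  move=> pA'.
  rewrite (_ : [set w | (ix n w <= j)%N] = [set w | a w <= g n j]); first exact: pA'.
  apply/seteqP; split => w /=; rewrite /ix gridindex_le// /g clamp_min ?gridpt_ge0//.
    by rewrite le_min => ->; rewrite andbT; have /andP[] := aT w.
  by rewrite le_min => /andP[].
have FE A' n j : prior a A' -> F (g n j) (E A' n j).
  move=> pA'; case: j => [|j].
    rewrite (_ : E A' n 0%N = A' `&` [set w | (ix n w <= 0)%N]); first exact: le_g.
    by congr (_ `&` _); apply/seteqP; split => w /=; rewrite leqn0 => /eqP.
  rewrite (_ : E A' n _ = (A' `&` [set w | (ix n w <= j.+1)%N]) `\`
                       (A' `&` [set w | (ix n w <= j)%N])).
    apply: FC => //; first exact: le_g.
    apply: incF (le_g A' n j pA') => //.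
    by rewrite /g !clamp_min ?gridpt_ge0// le_min !ge_min lexx /= le_gridpt ?orbT.
  apply/seteqP; split => w /=.
    by move=> [Aw ->]; split => //; rewrite ltnn => -[].
  move=> [[Aw h1] h2]; split => //; apply/eqP; rewrite eqn_leq h1 /= ltnNge.
  by apply/negP => h; apply: h2.
have mYn n : measurable_fun setT (Yn n).
  move=> _ C mC; rewrite setTI.
  rewrite (_ : _ @^-1` C = \bigcup_j (E setT n j `&` (Y (g n j) @^-1` C))).
    apply: bigcupT_measurable => j; apply: (mF (g n j)) => //; apply: FI => //.
      by apply: FE => t tT; rewrite setTI; exact: Fa.
    exact: aY.
  apply/seteqP; split => w /=; first by move=> CY; exists (ix n w).
  by move=> [j _ /= [[_ ixj] YC]]; rewrite /Yn ixj.
pose B n := A `&` [set w | `|Yn n w| <= K + 1].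
pose BE n j := E A n j `&` [set w | `|Y (g n j) w| <= K + 1].
have FBE n j : F (g n j) (BE n j).
  apply: FI => //; first exact: FE.
  have := aY _ (gT n j) `[- (K + 1), K + 1]%classic (measurable_itv _).
  by congr (F _ _); apply/seteqP; split => w /=; rewrite in_itv/= ler_norml.
have mBE n j : measurable (BE n j) by apply: mF (FBE n j).
have BU n : B n = \bigcup_j BE n j.
  apply/seteqP; split => w /=; first by move=> [Aw YB]; exists (ix n w).
  by move=> [j _ /= [[Aw ixj] YB]]; split => //; rewrite /= /Yn ixj.
have tBE n : trivIset setT (BE n).
  by move=> i j _ _ [w [[[_ <-] _] [[_ <-] _]]].
have mB n : measurable (B n) by rewrite BU; exact: bigcupT_measurable.
have iT : P.-integrable setT (EFin \o Y T) by apply: iY; rewrite T0 lexx.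
have mYT : measurable_fun setT (Y T).
  by apply: (measurable_for_fun T0); apply: aY; rewrite T0 lexx.
have discrete n : (\int[P]_(w in B n) (Yn n w)%:E = \int[P]_(w in B n) (Y T w)%:E)%E.
  rewrite BU integral_bigcup//; last first.
    rewrite -BU; apply: (@bounded_fun_integrable _ _ (K + 1)) => //.
    by move=> w [].
  rewrite [RHS]integral_bigcup//; last first.
    by rewrite -BU; apply: integrableS iT.
  apply: eq_eseriesr => j _.
  have [_ _ /(_ _ (FBE n j)) <-] := mY _ _ (g0 n j) (proj2 (andP (gT n j))) (lexx T).
  by apply: eq_integral => w; rewrite inE => -[[_ <-] _].
have Ycvg w : Yn n w @[n --> \oo] --> Y (a w) w.
  have cfs := @continuous_comp_clamp _ (fun t => Y t w) T T0 (cY w) (a w).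
  have : Y (g n (ix n w)) w @[n --> \oo] --> Y (clamp T (a w)) w.
    by apply: (cvg_comp _ _ (gridpt_cvg (a0 w)) cfs).
  by rewrite clamp_id.
(* This is the use of the margin in [K + 1]: once [Yn n w] is within 1 of [Y (a w) w], membership in
   [B n] and in [A] coincide. *)
have Bcvg w : \1_(B n) w @[n --> \oo] --> (\1_A w : R).
  apply: cvg_near_cst; rewrite !indicE.
  have /cvgrPdist_lt /(_ 1 ltr01) := Ycvg w; apply: filterS => n /= Yd.
  congr (_%:R : R); congr (nat_of_bool _); apply/idP/idP => [/set_mem[]|/set_mem] Aw; rewrite inE//.
  split => //=; rewrite -(subrK (Y (a w) w) (Yn n w)) addrC.
  by rewrite (le_trans (ler_normD _ _))// lerD// distrC ltW.
have lim1 : (\int[P]_(w in B n) (Yn n w)%:E)%E @[n --> \oo] -->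
            (\int[P]_(w in A) (Y (a w) w)%:E)%E.
  rewrite integral_EFin_indic; under eq_cvg do rewrite integral_EFin_indic.
  apply: (@dominated_cvg_EFin _ _ (cst (K + 1))).
  - by move=> n; apply: measurable_funM => //; exact: measurable_indic.
  - by apply: measurable_funM; [exact: measurable_stopped|exact: measurable_indic].
  - by apply: aeW => w; exact: cvgM.
  - by apply: finite_measure_integrable_cst.
  - move=> n w; rewrite indicE; have K0 := le_trans (normr_ge0 _) (YK w).
    have [/set_mem[_ /= YK1]|_] := boolP (w \in B n); first by rewrite mulr1.
    by rewrite mulr0 normr0 addr_ge0.
have lim2 : (\int[P]_(w in B n) (Y T w)%:E)%E @[n --> \oo] -->
            (\int[P]_(w in A) (Y T w)%:E)%E.
  rewrite integral_EFin_indic; under eq_cvg do rewrite integral_EFin_indic.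
  apply: (@dominated_cvg_EFin _ _ (fun w => `|Y T w|)).
  - by move=> n; apply: measurable_funM => //; exact: measurable_indic.
  - by apply: measurable_funM => //; exact: measurable_indic.
  - by apply: aeW => w; apply: cvgM => //; exact: cvg_cst.
  - exact: (integrable_abse iT).
  - move=> n w; rewrite normrM indicE normr_nat ler_piMr//.
    by case: (_ \in _).
move: lim1; rewrite (funext discrete) => lim1.
exact: (cvg_unique _ lim1 lim2).
Qed.

End optional_stopping.

Lemma within_continuous_eq {R : realType} (f g : R -> R) (T : R) :
  continuous g -> (forall t, 0 <= t <= T -> f t = g t) ->
  {within `[0, T], continuous f}.
Proof.
move=> cg fg; apply: (@subspace_eq_continuous _ _ _ g).
  by move=> t; rewrite inE /= in_itv /= => /fg/esym.
exact: continuous_subspaceT.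
Qed.

Lemma continuous_process_clamp {d : measure_display} {Omega : measurableType d}
    {R : realType} (T : R) (X : R -> Omega -> R) : 0 <= T ->
  continuous_process T X <-> forall w, continuous (fun t => X (clamp T t) w).
Proof.
move=> T0; split=> cX w; first exact: (continuous_comp_clamp T0 (cX w)).
by apply: within_continuous_eq (cX w) _ => t tT; rewrite clamp_id.
Qed.

Lemma continuous_increment {d : measure_display} {Omega : measurableType d}
    {R : realType} (T : R) (X : R -> Omega -> R) : 0 <= T ->
  continuous_process T X -> continuous_process T (fun t w => X t w - X 0 w).
Proof.
move=> T0 cX; apply/(continuous_process_clamp _ T0) => w t.
apply: (@continuousB _ _ _ (fun t => X (clamp T t) w)); last exact: cst_continuous.
exact: ((continuous_process_clamp X T0).1 cX).
Qed.

(** * Optional stopping of bounded continuous local martingales *)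

Section local_martingale.
Context {d : measure_display} {Omega : measurableType d} {R : realType}.
Variables (P : probability Omega R) (F : R -> set (set Omega)) (T : R).
Hypotheses (FF : filtration F) (T0 : 0 <= T).

Lemma continuous_stopped (tau : Omega -> R) (X : R -> Omega -> R) :
  continuous_process T X -> (forall w, 0 <= tau w) ->
  continuous_process T (stopped tau X).
Proof.
move=> cX tau0 w; apply: (@within_continuous_eq _ _
    ((fun t => X t w) \o clamp T \o (fun t => Num.min t (tau w)))).
  move=> t; apply: continuous_comp; last exact: continuous_comp_clamp.
  by apply: continuous_min; [exact: cvg_id|exact: cst_continuous].
move=> t /andP[t0 tT]; rewrite /stopped /= clamp_id//.
by rewrite le_min t0 tau0/= ge_min tT.
Qed.

Lemma prior_le (a b : Omega -> R) (A : set Omega) : stopping_upto F T b ->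
  (forall w, a w <= b w) -> prior F T a A -> prior F T b A.
Proof.
move=> [_ Fb] ab pA t tT; have /andP[t0 _] := tT; have [sF _ _] := FF.
rewrite (_ : _ `&` _ = (A `&` [set w | a w <= t]) `&` [set w | b w <= t]).
  rewrite -(measurable_g_measurableTypeE (sF _ t0)).
  by apply: measurableI; rewrite measurable_g_measurableTypeE; auto.
apply/seteqP; split => w /=; last by move=> [[]].
by move=> [Aw bt]; split => //; split => //; apply: le_trans bt.
Qed.

(** For each n, optional stopping of the localized martingale [Y n] at [a] and at [b] gives the same
    number, the integral of [Y n T] over [A]. Letting n grow removes the localization by domination.
    The bound is assumed on all of [0, b] because [tau n] may stop the path before [a] or [b]. *)
Lemma local_martingale_stopping (X : R -> Omega -> R) (a b : Omega -> R)
    (A : set Omega) (K : R) :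
  local_martingale P F T X -> continuous_process T X ->
  stopping_upto F T a -> stopping_upto F T b -> (forall w, a w <= b w) ->
  (forall w t, 0 <= t <= b w -> `|X t w - X 0 w| <= K) -> prior F T a A ->
  (\int[P]_(w in A) (X (b w) w - X 0 w)%:E =
   \int[P]_(w in A) (X (a w) w - X 0 w)%:E)%E.
Proof.
move=> [aX [tau [stau tau_inc mX]]] cX sa sb ab XK pA.
pose Y n t w := stopped (tau n) X t w - X 0 w.
have tau0 n w : 0 <= tau n w by have [] := stau n.
have cY n : continuous_process T (Y n).
  move=> w; have cs := continuous_stopped cX (tau0 n).
  apply: (@within_continuous_eq _ _
    (fun t => stopped (tau n) X (clamp T t) w - X 0 w)).
    move=> t; apply: continuousB; last exact: cst_continuous.
    exact: (continuous_comp_clamp T0 (cs w)).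
  by move=> t tT; rewrite clamp_id.
have mA := prior_measurable FF T0 sa pA.
have pbA := prior_le sb ab pA.
have mX0 : measurable_fun setT (X 0).
  by apply: (measurable_for_fun FF (lexx 0)); apply: aX; rewrite lexx.
have lim (c : Omega -> R) : stopping_upto F T c -> (forall w, c w <= b w) ->
    prior F T c A ->
    (\int[P]_(w in A) (Y n T w)%:E)%E @[n --> \oo] -->
    (\int[P]_(w in A) (X (c w) w - X 0 w)%:E)%E.
  move=> sc cb pcA; have [cT _] := sc.
  have YK n w : `|Y n (c w) w| <= K.
    have /andP[c0 _] := cT w.
    by apply: XK; rewrite le_min c0 tau0/= ge_min cb.
  rewrite integral_EFin_indic (_ : (fun n => _) =
      fun n => (\int[P]_w (Y n (c w) w * \1_A w)%:E)%E); last first.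
    apply/funext => n; rewrite -integral_EFin_indic.
    by rewrite (optional_stopping FF T0 (mX _) (cY _) sc (YK _) pcA).
  apply: (@dominated_cvg_EFin _ _ _ _ _ _ (cst K)).
  - move=> n; apply: measurable_funM; last exact: measurable_indic.
    by apply: (measurable_stopped FF T0 _ (cY n) sc); have [] := mX n.
  - apply: measurable_funM; last exact: measurable_indic.
    by apply: measurable_funB => //; exact: (measurable_stopped FF T0 aX cX sc).
  - apply: filterS tau_inc => w [ndtau [m Tm]].
    apply: cvg_near_cst; exists m => // n /= mn; rewrite /Y /stopped min_l//.
    have /andP[_ cT'] := cT w.
    by rewrite (le_trans cT')// (le_trans Tm)// ndtau.
  - by apply: finite_measure_integrable_cst.
  - move=> n w; have := YK n w; rewrite normrM indicE normr_nat => /(le_trans _); apply.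
    by rewrite ler_piMr//; case: (_ \in _).
exact: (cvg_unique _ (lim b sb (fun w => lexx _) pbA) (lim a sa ab pA)).
Qed.

End local_martingale.

(** * The good-lambda inequality *)

(** Countable additivity passes the inequality from the cells of [f], intervals of length [e], to
    the whole space. It is applied to [f = M 0], which is almost constant on each cell. *)
Lemma le_probability_cells {d : measure_display} {Omega : measurableType d}
    {R : realType} (P : probability Omega R) (f : Omega -> R) (e x y : R)
    (E1 E2 : set Omega) :
  measurable_fun setT f -> 0 < e -> 0 <= x -> 0 <= y ->
  measurable E1 -> measurable E2 ->
  (forall j : int, let B := f @^-1` `[j%:~R * e, (j + 1)%:~R * e[%classic in
    x * fine (P (E1 `&` B)) <= y * fine (P (E2 `&` B))) ->
  x * fine (P E1) <= y * fine (P E2).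
Proof.
move=> mf e0 x0 y0 mE1 mE2 H.
pose I (j : int) := f @^-1` `[j%:~R * e, (j + 1)%:~R * e[%classic.
(* The cells are indexed by integers; they are renumbered by naturals to sum a series, and a natural
   that codes no integer gets the empty set. *)
pose B n := if @pickle_inv int n is Some j then I j else set0.
have mI j : measurable (I j).
  by rewrite -[I j]setTI; apply: mf => //; exact: measurable_itv.
have mB n : measurable (B n) by rewrite /B; case: pickle_inv.
have Ij j w : I j w -> j = Num.floor (f w / e).
  rewrite /I /= in_itv /= -ler_pdivlMr// -ltr_pdivrMr// => /floor_def.
  by move->.
have tB : trivIset setT B.
  move=> m n _ _ [w []]; rewrite /B.
  have := @pickle_invK int m; have := @pickle_invK int n.
  case: pickle_inv => //= j <-; case: pickle_inv => //= k <-.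
  by move=> /Ij -> /Ij ->.
have BT : \bigcup_n B n = setT.
  apply/seteqP; split => // w _; exists (pickle (Num.floor (f w / e))).
    exact: Logic.I.
  rewrite /B pickleK_inv /I /= in_itv /= -ler_pdivlMr// -ltr_pdivrMr//.
  by rewrite floor_le_tmp floorD1_gt.
have PE (E : set Omega) : measurable E -> P E = (\sum_(n <oo) P (E `&` B n))%E.
  move=> mE; rewrite -[in LHS](setIT E) -BT setI_bigcupr measure_bigcup//.
  - by apply: eq_eseriesl => n; rewrite in_setT.
  - by move=> n _; exact: measurableI.
  - exact: trivIset_setIl.
have PEfin (E : set Omega) : measurable E -> P E \is a fin_num.
  by move=> mE; exact: fin_num_measure.
rewrite -lee_fin !EFinM !fineK ?PEfin// (PE E1)// (PE E2)// -!nneseriesZl//.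
apply: lee_nneseries => [n _ _|n _]; first by rewrite mule_ge0.
have -> : P (E1 `&` B n) = (fine (P (E1 `&` B n)))%:E.
  by rewrite fineK// PEfin//; exact: measurableI.
have -> : P (E2 `&` B n) = (fine (P (E2 `&` B n)))%:E.
  by rewrite fineK// PEfin//; exact: measurableI.
rewrite -!EFinM lee_fin /B; case: pickle_inv => [j|]; first exact: H.
by rewrite !setI0 measure0 !mulr0.
Qed.

Section good_lambda.
Context {d : measure_display} {Omega : measurableType d} {R : realType}.
Variables (P : probability Omega R) (F : R -> set (set Omega)) (T : R).
Hypotheses (FF : filtration F) (T0 : 0 <= T).
Variables (M Q : R -> Omega -> R).
Hypotheses (lM : local_martingale P F T M) (cM : continuous_process T M).
Hypothesis QV : is_quadratic_variation P F T M Q.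

Let N t w := M t w - M 0 w.
Let X t w := M t w ^+ 2 - Q t w.

Definition level (Y : R -> Omega -> R) (l : R) : set Omega :=
  [set w | exists t, 0 <= t <= T /\ l <= Y t w].

Lemma level_measurable (Y : R -> Omega -> R) (l : R) :
  adapted F T Y -> continuous_process T Y -> measurable (level Y l).
Proof.
move=> aY cY; have [_ mF _] := FF; apply: (mF T T0).
by apply: (measurable_exists_ge FF (T := T)) => //; rewrite T0 lexx.
Qed.

Let aM : adapted F T M. Proof. by have [] := lM. Qed.
Let aQ : adapted F T Q. Proof. by have [] := QV. Qed.
Let cQ : continuous_process T Q. Proof. by have [] := QV. Qed.
Let Q0 w : Q 0 w = 0. Proof. by have [] := QV. Qed.
Let lX : local_martingale P F T X. Proof. by have [] := QV. Qed.
Let aX : adapted F T X. Proof. by have [] := lX. Qed.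
Let clampM := (continuous_process_clamp M T0).1 cM.
Let clampQ := (continuous_process_clamp Q T0).1 cQ.
Let clampX w : continuous (fun t => X (clamp T t) w).
Proof.
move=> t; apply: (@continuousB _ _ _ (fun t => M (clamp T t) w ^+ 2)); last exact: clampQ.
by apply: (@continuousM _ _ (fun t => M (clamp T t) w)); exact: clampM.
Qed.
Let cX : continuous_process T X.
Proof. by apply/(continuous_process_clamp X T0) => w; exact: clampX. Qed.
Let clampN w : continuous (fun t => N (clamp T t) w).
Proof.
by move=> t; apply: (@continuousB _ _ _ (fun t => M (clamp T t) w)); [exact: clampM|exact: cst_continuous].
Qed.

Let adapted_fun (Y : R -> Omega -> R) t : 0 <= t <= T -> adapted F T Y ->
  measurable_fun [set: g_sigma_algebraType (F t)] (Y t).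
Proof.
move=> tT aY; have [sF _ _] := FF; have /andP[t0 _] := tT.
by apply/measurable_forP; [exact: sF|exact: aY].
Qed.

Let adapted_fun0 (Y : R -> Omega -> R) t : 0 <= t <= T -> adapted F T Y ->
  measurable_fun [set: g_sigma_algebraType (F t)] (Y 0).
Proof.
move=> tT aY; have [sF _ incF] := FF; have /andP[t0 _] := tT.
apply/measurable_forP; first exact: sF.
by move=> B mB; apply: (incF 0 t) => //; apply: aY => //; rewrite lexx.
Qed.

Let aN : adapted F T N.
Proof.
move=> t tT; have [sF _ _] := FF; have /andP[t0 _] := tT.
apply/measurable_forP; first exact: sF.
by apply: measurable_funB; [exact: adapted_fun|exact: adapted_fun0].
Qed.

(* Controlling X - X_0 along with N keeps both stopped local martingales bounded
   although M_0 is arbitrary. *)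
Let VV K t w := Num.max (`|N t w| / K) (`|X t w - X 0 w| / K).

Let clampV K w : continuous (fun t => VV K (clamp T t) w).
Proof.
pose f3 t := `|N (clamp T t) w| / K.
pose f4 t := `|X (clamp T t) w - X 0 w| / K.
have norm_div (f : R -> R) (r : R) : continuous f -> continuous (fun t => `|f t| / r).
  move=> cf x; apply: (@continuousM _ _ (fun t => `|f t|) (cst r^-1)).
    by apply: (@continuous_comp _ _ _ f); [exact: cf|exact: norm_continuous].
  exact: cst_continuous.
have c3 : continuous f3 by apply: norm_div; exact: clampN.
have c4 : continuous f4.
  apply/norm_div => x; apply: (@continuousB _ _ _ (fun t => X (clamp T t) w)).
    exact: clampX.
  exact: cst_continuous.
by move=> t; apply: (@continuous_max _ _ f3 f4); [exact: c3|exact: c4].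
Qed.

Let cV K : continuous_process T (VV K).
Proof. by apply/continuous_process_clamp => // w; exact: clampV. Qed.

Let measurable_V K t : 0 <= t <= T ->
  measurable_fun [set: g_sigma_algebraType (F t)] (VV K t).
Proof.
move=> tT; apply: measurable_maxr; apply: measurable_funM => //.
- by apply: measurableT_comp => //; exact: adapted_fun.
- apply: measurableT_comp => //; apply: measurable_funB; first exact: adapted_fun.
  exact: adapted_fun0.
Qed.

Let aV K : adapted F T (VV K).
Proof.
move=> t tT; have [sF _ _] := FF; have /andP[t0 _] := tT.
by apply/measurable_forP; [exact: sF|exact: measurable_V].
Qed.

Section level_estimate.
Variables (s l D K : R).
Hypotheses (ss : s * s = 1) (l0 : 0 < l) (D0 : 0 < D) (K0 : 0 < K).

(** Here [s] is 1 or -1. With a sign fixed, N equals the constant [s * l] whenever level [l] has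
    just been reached, whereas |N| = l would leave the sign random. *)
Let sN t w := s * N t w.

Let V := VV K.

(** Each control is divided by its threshold, so that hitting level 1 by the maximum stops at the
    first of the events: [sN] at 2 l, [Q] at D l^2, or [V] at 1. *)
Let W t w := Num.max (Num.max (sN t w / (2 * l)) (Q t w / (D * l ^+ 2))) (V t w).

Let clampsN w : continuous (fun t => sN (clamp T t) w).
Proof.
move=> t; apply: (@continuousM _ _ (cst s) (fun t => N (clamp T t) w)).
  exact: cst_continuous.
exact: clampN.
Qed.

Let csN : continuous_process T sN.
Proof. by apply/continuous_process_clamp => // w; exact: clampsN. Qed.

Let cW : continuous_process T W.
Proof.
apply/continuous_process_clamp => // w t.
pose f1 t := sN (clamp T t) w / (2 * l).
pose f2 t := Q (clamp T t) w / (D * l ^+ 2).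
have div_cst (f : R -> R) (r : R) : continuous f -> continuous (fun t => f t / r).
  move=> cf x; apply: (@continuousM _ _ f (cst r^-1)); first exact: cf.
  exact: cst_continuous.
have c1 : continuous f1 by apply: div_cst; exact: clampsN.
have c2 : continuous f2 by apply: div_cst; exact: clampQ.
apply: (@continuous_max _ _ (f1 \max f2)); last exact: clampV.
by apply: continuous_max; [exact: c1|exact: c2].
Qed.

Let asN : adapted F T sN.
Proof.
move=> t tT; have [sF _ _] := FF; have /andP[t0 _] := tT.
apply/measurable_forP; first exact: sF.
by apply: measurable_funM => //; exact: adapted_fun.
Qed.

Let aW : adapted F T W.
Proof.
move=> t tT; have [sF _ _] := FF; have /andP[t0 _] := tT.
apply/measurable_forP; first exact: sF.
apply: measurable_maxr; last exact: measurable_V.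
by apply: measurable_maxr; apply: measurable_funM => //; exact: adapted_fun.
Qed.

(** [a] is capped by [b] so that the two times are ordered; [A] is the event that level [l] is
    reached no later than [b]. [G] is the event to be estimated, without the paths that [V] would
    stop. *)
Let h := hitting T sN l.
Let b := hitting T W 1.
Let a w := Num.min (h w) (b w).
Let A := [set w | l <= sN (a w) w].
Let G := (level sN (2 * l) `&` [set w | Q T w < D * l ^+ 2]) `\` level V 1.

Let sh : stopping_upto F T h. Proof. exact: hitting_stopping. Qed.
Let sb : stopping_upto F T b. Proof. exact: hitting_stopping. Qed.
Let sa : stopping_upto F T a. Proof. exact: stopping_upto_min. Qed.
Let ab w : a w <= b w. Proof. by rewrite /a ge_min lexx orbT. Qed.
Let ah w : a w <= h w. Proof. by rewrite /a ge_min lexx. Qed.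
Let N0 w : N 0 w = 0. Proof. by rewrite /N subrr. Qed.

Let WP t w : W t w <= 1 -> [/\ sN t w <= 2 * l, Q t w <= D * l ^+ 2,
  `|N t w| <= K & `|X t w - X 0 w| <= K].
Proof.
rewrite /W /V /VV !ge_max !ler_pdivrMr ?mulr_gt0 ?exprn_gt0// !mul1r.
by move=> /andP[/andP[-> ->] /andP[-> ->]].
Qed.

Let le_b t w : 0 <= t <= b w -> [/\ sN t w <= 2 * l, Q t w <= D * l ^+ 2,
  `|N t w| <= K & `|X t w - X 0 w| <= K].
Proof.
move=> /andP[t0 tb]; apply: WP; apply: (le_hitting T0 cW) tb => //.
by rewrite /W /V /VV /sN N0 Q0 subrr normr0 mulr0 !mul0r !maxxx ler01.
Qed.

Let a_itv w : 0 <= a w <= b w.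
Proof. by have [/(_ w)/andP[-> _] _] := sa; rewrite ab. Qed.

Let b_itv w : 0 <= b w <= b w.
Proof. by have [/(_ w)/andP[-> _] _] := sb; rewrite lexx. Qed.

Let sN_a w : A w -> sN (a w) w = l.
Proof.
move=> lsN; apply/eqP; rewrite eq_le lsN andbT; have /andP[a0 _] := a_itv w.
by apply: (le_hitting T0 csN) => //; rewrite /sN N0 mulr0 ltW.
Qed.

Let prior_A : prior F T a A.
Proof.
move=> t tT; have [sF _ incF] := FF; have /andP[t0 _] := tT; have [aT Fa] := sa.
(* On {a <= t} the value at [a] is the value at min(t, a), which is [F t]-measurable. *)
rewrite (_ : _ `&` _ = [set w | l <= sN (Num.min t (a w)) w] `&` [set w | a w <= t]).
  rewrite -(measurable_g_measurableTypeE (sF _ t0)); apply: measurableI.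
    have := @measurable_at_stopping _ _ _ _ _ FF _ a t tT asN csN.
    have a0 w : 0 <= a w by have /andP[] := aT w.
    move=> /(_ a0 _ `[l, +oo[%classic (measurable_itv _)).
    rewrite measurable_g_measurableTypeE; last exact: sF.
    rewrite (_ : _ @^-1` _ = [set w | l <= sN (Num.min t (a w)) w]); last first.
      by apply/seteqP; split => w /=; rewrite in_itv /= andbT.
    apply=> u /andP[u0 ut]; apply: (incF u t) => //; apply: Fa.
    by rewrite u0 (le_trans ut)//; have /andP[] := tT.
  rewrite measurable_g_measurableTypeE; last exact: sF.
  exact: Fa.
apply/seteqP; split => w; rewrite /A /= => -[lw aw]; split => //.
  by rewrite (min_r aw).
by rewrite -(min_r aw).
Qed.

(** On [G] the maximum [W] reaches 1, and only its first component can be responsible: [Q] stays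
    below its threshold since it is nondecreasing with [Q T w < D * l ^+ 2], and [V] stays below 1.
    As 2 l >= l, level [l] has been reached by then too. *)
Let G_b w : G w -> A w /\ 2 * l <= sN (b w) w.
Proof.
move=> [[/= [t [tT lsN]] QT] nV].
have bT : 0 <= b w <= T by have [+ _] := sb; exact.
have lb : 2 * l <= sN (b w) w.
  have : 1 <= W (b w) w.
    apply: (hitting_ge T0 cW); exists t; split => //.
    by rewrite /W !le_max ler_pdivlMr ?mulr_gt0// mul1r lsN.
  rewrite /W !le_max !ler_pdivlMr ?mulr_gt0 ?exprn_gt0// !mul1r.
  move=> /orP[/orP[lsNb|QD]|V1]; [exact: lsNb| |]; last first.
    case: nV; exists (b w); split => //.
    by rewrite /V /VV le_max !ler_pdivlMr// !mul1r.
  move: QT; rewrite ltNge; have [_ _ _ ndQ _] := QV.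
  by have /andP[b0 b1] := bT; rewrite (le_trans QD)// ndQ.
split => //.
have lsNb : l <= sN (b w) w by apply: le_trans lb; rewrite ler_peMl// ?ler1n// ltW.
have hb : h w <= b w by apply: (hitting_le T0) => //.
rewrite /A /= /a min_l//; apply: (hitting_ge T0 csN).
by exists (b w).
Qed.

Let mM0 : measurable_fun setT (M 0).
Proof. by apply: (measurable_for_fun FF (lexx 0)); apply: aM; rewrite lexx. Qed.

Let mV1 : measurable (level V 1).
Proof. apply: level_measurable; [exact: aV|exact: cV]. Qed.

Lemma measurable_signed_level (r : R) : measurable (level (fun t w => s * N t w) r).
Proof. apply: level_measurable; [exact: asN|exact: csN]. Qed.

Lemma measurable_bounded_event :
  measurable ((level (fun t w => s * N t w) (2 * l) `&`
    [set w | Q T w < D * l ^+ 2]) `\` level (VV K) 1).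
Proof.
apply: measurableD => //; apply: measurableI; first exact: level_measurable.
have mQT : measurable_fun setT (Q T).
  by apply: (measurable_for_fun FF T0); apply: aQ; rewrite T0 lexx.
have := mQT measurableT `]-oo, D * l ^+ 2[%classic (measurable_itv _).
by rewrite setTI; congr measurable; apply/seteqP; split => w /=; rewrite in_itv.
Qed.

Let mG : measurable G := measurable_bounded_event.

Let increment_integrable (Y : R -> Omega -> R) (t : Omega -> R) (C : set Omega) :
  adapted F T Y -> continuous_process T Y -> stopping_upto F T t ->
  (forall w, `|Y (t w) w - Y 0 w| <= K) -> measurable C ->
  P.-integrable C (EFin \o (fun w => Y (t w) w - Y 0 w)).
Proof.
move=> aY cY st YK mC; apply: (@bounded_fun_integrable _ _ _ _ _ _ K) => //.
apply: measurable_funB; first exact: (measurable_stopped FF T0 aY cY st).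
by apply: (measurable_for_fun FF (lexx 0)); apply: aY; rewrite lexx.
Qed.

(* On A the value of N at time a is s l, hence
     (N_b - N_a)^2 = (X_b - X_a) + (Q_b - Q_a) - 2 (c + s l) (N_b - N_a)
                     - 2 (M_0 - c) (N_b - N_a),
   where the first and third terms have mean zero on A `&` B.  Restricting to a
   set B on which M_0 is almost constant makes the last term negligible. *)
Let piece_estimate (B : set Omega) (c e : R) : F 0 B -> 0 <= e ->
  (forall w, B w -> `|M 0 w - c| <= e) ->
  l ^+ 2 * fine (P (G `&` B)) <= (D * l ^+ 2 + 4 * e * K) * fine (P (A `&` B)).
Proof.
move=> F0B e0 Bc; pose C := A `&` B; have [sF mF incF] := FF.
have mB : measurable B by apply: mF F0B.
have pC : prior F T a C.
  move=> t tT; have /andP[t0 _] := tT.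
  rewrite /C setIAC -(measurable_g_measurableTypeE (sF _ t0)).
  apply: measurableI; (rewrite measurable_g_measurableTypeE; last exact: sF).
    exact: prior_A.
  exact: (incF 0 t (lexx 0) t0 _ F0B).
have mC : measurable C by exact: (prior_measurable FF T0 sa pC).
have KX w : `|X (b w) w - X 0 w| <= K /\ `|X (a w) w - X 0 w| <= K.
  by have [_ _ _ ?] := le_b (b_itv w); have [_ _ _ ?] := le_b (a_itv w).
have KN w : `|M (b w) w - M 0 w| <= K /\ `|M (a w) w - M 0 w| <= K.
  by have [_ _ ? _] := le_b (b_itv w); have [_ _ ? _] := le_b (a_itv w).
have iXb : P.-integrable C (EFin \o (fun w => X (b w) w - X 0 w)).
  by apply: (increment_integrable aX cX sb _ mC) => w; case: (KX w).
have iXa : P.-integrable C (EFin \o (fun w => X (a w) w - X 0 w)).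
  by apply: (increment_integrable aX cX sa _ mC) => w; case: (KX w).
have iMb : P.-integrable C (EFin \o (fun w => M (b w) w - M 0 w)).
  by apply: (increment_integrable aM cM sb _ mC) => w; case: (KN w).
have iMa : P.-integrable C (EFin \o (fun w => M (a w) w - M 0 w)).
  by apply: (increment_integrable aM cM sa _ mC) => w; case: (KN w).
have EX : \int[P]_(w in C) (X (b w) w - X 0 w) =
          \int[P]_(w in C) (X (a w) w - X 0 w).
  congr fine; apply: (local_martingale_stopping FF T0 lX cX sa sb ab _ pC (K := K)).
  by move=> w t /le_b[].
have EM : \int[P]_(w in C) (M (b w) w - M 0 w) =
          \int[P]_(w in C) (M (a w) w - M 0 w).
  congr fine; apply: (local_martingale_stopping FF T0 lM cM sa sb ab _ pC (K := K)).
  by move=> w t /le_b[].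
have iC (r : R) : P.-integrable C (EFin \o cst r).
  by apply: (@bounded_fun_integrable _ _ _ _ _ _ `|r|).
pose u w := (X (b w) w - X 0 w) - (X (a w) w - X 0 w).
pose v w := 2 * (c + s * l) * ((M (b w) w - M 0 w) - (M (a w) w - M 0 w)).
have iu : P.-integrable C (EFin \o u) by exact: (integrableB mC iXb iXa).
have iv : P.-integrable C (EFin \o v).
  exact: (integrableZl mC (2 * (c + s * l)) (integrableB mC iMb iMa)).
have -> : l ^+ 2 * fine (P (G `&` B)) = \int[P]_(w in C) (l ^+ 2 * \1_G w).
  rewrite RintegralZl//; last first.
    apply: (@bounded_fun_integrable _ _ _ _ _ _ 1) => // w _.
    by rewrite indicE normr_nat; case: (_ \in _).
  have GA : G `&` A = G by apply/setIidl => w /G_b[].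
  by congr (_ * fine _); rewrite integral_indic// /C setIA GA.
have iuc : P.-integrable C (EFin \o (fun w => u w + (D * l ^+ 2 + 4 * e * K))).
  exact: (integrableD mC iu (iC _)).
apply: (@le_trans _ _ (\int[P]_(w in C) (u w + (D * l ^+ 2 + 4 * e * K) - v w))).
  apply: le_Rintegral => //.
  - apply: (@bounded_fun_integrable _ _ _ _ _ _ (l ^+ 2)) => //.
      by apply: measurable_funM => //; exact: measurable_indic.
    move=> w _; rewrite indicE ger0_norm ?mulr_ge0 ?(ltW l0)//.
    by case: (_ \in _); rewrite ?mulr1// mulr0 sqr_ge0.
  - exact: (integrableB mC iuc iv).
  - move=> w [Aw Bw].
    have [_ Qb Kb _] := le_b (b_itv w); have [_ _ Ka _] := le_b (a_itv w).
    have Qa : 0 <= Q (a w) w.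
      have [_ _ _ ndQ _] := QV; rewrite -(Q0 w); have [/(_ w)/andP[a0 aT] _] := sa.
      exact: ndQ.
    have Na : N (a w) w = s * l by rewrite -(sN_a Aw) /sN mulrA ss mul1r.
    have -> : u w + (D * l ^+ 2 + 4 * e * K) - v w =
        (N (b w) w - N (a w) w) ^+ 2 + (D * l ^+ 2 - Q (b w) w) + Q (a w) w +
        (2 * (M 0 w - c) * (N (b w) w - N (a w) w) + 4 * e * K).
      by rewrite /u /v -Na /X /N; ring.
    (* The slack 4 e K is (2 e)(2 K), from |M_0 - c| <= e and |N_b - N_a| <= 2 K. *)
    have cross : 0 <= 2 * (M 0 w - c) * (N (b w) w - N (a w) w) + 4 * e * K.
      rewrite -lerBlDr sub0r lerNl; apply: le_trans (ler_norm _) _.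
      rewrite normrN !normrM (ger0_norm (ler0n _ 2)).
      have -> : 4 * e * K = (2 * e) * (K + K) by ring.
      apply: ler_pM; rewrite ?mulr_ge0// ?ler_pM2l ?Bc//.
      by apply: (le_trans (ler_normB _ _)); exact: lerD.
    rewrite -[leLHS]addr0; apply: lerD => //; rewrite -[leLHS]addr0; apply: lerD => //.
    rewrite -[leLHS]addr0; apply: lerD; last by rewrite subr_ge0.
    rewrite indicE; have [/set_mem Gw|_] := boolP (w \in G).
      have [_ lb] := G_b Gw; rewrite mulr1.
      have -> : (N (b w) w - N (a w) w) ^+ 2 = (sN (b w) w - l) ^+ 2.
        rewrite -(sN_a Aw) /sN -mulrBr exprMn (_ : s ^+ 2 = 1) ?mul1r//.
      have ll : l <= sN (b w) w - l by lra.
      by rewrite ler_pXn2r// nnegrE ltW// (lt_le_trans l0).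
    by rewrite mulr0 sqr_ge0.
rewrite RintegralB// RintegralD//; last exact: iC.
rewrite RintegralB// EX subrr add0r RintegralZl//; last exact: (integrableB mC iMb iMa).
by rewrite RintegralB// EM subrr mulr0 subr0 Rintegral_cst.
Qed.

Lemma good_lambda_bounded :
  fine (P ((level (fun t w => s * N t w) (2 * l) `&` [set w | Q T w < D * l ^+ 2])
    `\` level (VV K) 1)) <=
  D * fine (P (level (fun t w => s * N t w) l)).
Proof.
rewrite -[X in P X]/G -[X in D * fine (P X)]/(level sN l).
have [sF mF _] := FF; have [aT _] := sa.
have mA : measurable A by have := prior_measurable FF T0 sa prior_A.
have mL : measurable (level sN l) by exact: level_measurable.
have AL : fine (P A) <= fine (P (level sN l)).
  apply: fine_le; rewrite ?fin_num_measure//; apply: le_measure; rewrite ?inE//.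
  move=> w Aw; exists (a w); split => //.
have D0' := ltW D0; apply: (le_trans _ (ler_wpM2l D0' AL)).
have l20 : 0 < l ^+ 2 by rewrite exprn_gt0.
rewrite -(ler_pM2l l20); apply/ler_addgt0Pr => r r0.
(* With this mesh the error 4 e K on each cell is r, and summing over the cells costs at most r P(A)
   <= r. *)
pose e := r / (4 * K).
have e0 : 0 < e by rewrite divr_gt0// mulr_gt0.
have := @le_probability_cells _ _ _ P (M 0) e (l ^+ 2) (D * l ^+ 2 + 4 * e * K) G A
  mM0 e0 (ltW l20) _ mG mA.
have eK : 4 * e * K = r by rewrite /e; field; rewrite gt_eqF.
rewrite eK addr_ge0 ?mulr_ge0 ?(ltW l0) ?(ltW r0)// => /(_ isT) H.
apply: (le_trans (H _)).
  move=> j; rewrite -eK; apply: (@piece_estimate _ (j%:~R * e)).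
  - by apply: aM; rewrite ?lexx.
  - exact: ltW.
  - move=> w; rewrite /= in_itv /= intrD mulrDl mul1r => /andP[h1 h2].
    by rewrite ger0_norm ?subr_ge0// lerBlDl ltW.
rewrite mulrDl [D * _]mulrC mulrA lerD2l ler_piMr ?(ltW r0)// -lee_fin fineK.
  exact: probability_le1.
exact: fin_num_measure.
Qed.

End level_estimate.

(** The truncation by [K] is removed: continuous paths are bounded on [0, T], so with K = k + 1 the
    truncated events increase to the full one, and the bound does not involve K. *)
Lemma good_lambda_signed (s l D : R) : s * s = 1 -> 0 < l -> 0 < D ->
  fine (P (level (fun t w => s * N t w) (2 * l) `&` [set w | Q T w < D * l ^+ 2])) <=
  D * fine (P (level (fun t w => s * N t w) l)).
Proof.
move=> ss l0 D0; set E := _ `&` _; pose G (k : nat) := E `\` level (VV k.+1%:R) 1.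
have mG k : measurable (G k) by apply: measurable_bounded_event.
have EG : \bigcup_k G k = E.
  apply/seteqP; split => [w [k _ []//]|w Ew].
  have [c _ cmax] := EVT_max T0 (@cV 1 w).
  exists (Num.trunc `|VV 1 c w|) => //; split => // -[t [tT]].
  have : VV 1 t w <= VV 1 c w by apply: cmax; rewrite in_itv.
  rewrite /VV !divr1 => Vc; apply/negP; rewrite -ltNge gt_max !ltr_pdivrMr// !mul1r -gt_max.
  apply: (le_lt_trans Vc); apply: (le_lt_trans (ler_norm _)).
  exact: truncnS_gt.
have ndG : {homo G : n m / (n <= m)%N >-> (n <= m)%O}.
  move=> n m nm; apply/subsetPset => w [Ew nV]; split => // -[t [tT Vm]].
  apply: nV; exists t; split => //; apply: (le_trans Vm).
  have mn : (m.+1%:R : R)^-1 <= n.+1%:R^-1 by rewrite lef_pV2 ?posrE// ler_nat.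
  by rewrite /VV ge_max !le_max !ler_wpM2l//= orbT.
have mE : measurable E by rewrite -EG; exact: bigcupT_measurable.
have mL : measurable (level (fun t w => s * N t w) l).
  exact: measurable_signed_level.
rewrite -lee_fin fineK ?fin_num_measure//.
have Gcvg := @nondecreasing_cvg_mu _ _ _ P G mG (bigcupT_measurable G mG) ndG.
rewrite EG in Gcvg.
apply: (cvge_le _ Gcvg); apply: nearW => k /=.
rewrite -(@fineK _ (P (G k))) ?fin_num_measure// lee_fin.
exact: good_lambda_bounded.
Qed.

Let level_norm l : level (fun t w => `|N t w|) l =
  level (fun t w => 1 * N t w) l `|` level (fun t w => -1 * N t w) l.
Proof.
apply/seteqP; split => w /=; rewrite /level /=.
  move=> [t [tT]]; rewrite ler_normr => /orP[lN|lN]; [left|right]; exists t.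
    by rewrite mul1r.
  by rewrite mulN1r.
by move=> [|] [t [tT lN]]; exists t; split => //; rewrite ler_normr -mulN1r -{1}[N t w]mul1r lN ?orbT.
Qed.

Lemma measurable_level_norm l : measurable (level (fun t w => `|N t w|) l).
Proof.
by rewrite level_norm; apply: measurableU; exact: measurable_signed_level.
Qed.

Lemma measurable_QT_lt (x : R) : measurable [set w | Q T w < x].
Proof.
have mQT : measurable_fun setT (Q T).
  by apply: (measurable_for_fun FF T0); apply: aQ; rewrite T0 lexx.
have := mQT measurableT `]-oo, x[%classic (measurable_itv _).
by rewrite setTI; congr measurable; apply/seteqP; split => w /=; rewrite in_itv.
Qed.

(** |N| reaches 2 l when N or -N does; each sign contributes D times the probability that |N|
    reaches l. *)
Lemma good_lambda (l D : R) : 0 < l -> 0 < D ->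
  fine (P (level (fun t w => `|N t w|) (2 * l) `&` [set w | Q T w < D * l ^+ 2])) <=
  2 * D * fine (P (level (fun t w => `|N t w|) l)).
Proof.
move=> l0 D0.
have mS s r := @measurable_signed_level s r.
have mQ := measurable_QT_lt (D * l ^+ 2).
have signed s : s * s = 1 -> level (fun t w => s * N t w) l `<=`
    level (fun t w => `|N t w|) l ->
    fine (P (level (fun t w => s * N t w) (2 * l) `&` [set w | Q T w < D * l ^+ 2])) <=
    D * fine (P (level (fun t w => `|N t w|) l)).
  move=> ss sub; apply: (le_trans (good_lambda_signed ss l0 D0)).
  rewrite ler_pM2l//; apply: fine_le; rewrite ?fin_num_measure//.
    exact: measurable_level_norm.
  by apply: le_measure; rewrite ?inE//; exact: measurable_level_norm.
have h1 := signed 1; have h2 := signed (-1).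
rewrite {1}level_norm setIUl.
rewrite (_ : 2 * D * _ = D * fine (P (level (fun t w => `|N t w|) l)) +
   D * fine (P (level (fun t w => `|N t w|) l))); last by ring.
apply: (@le_trans _ _ (fine (P (level (fun t w => 1 * N t w) (2 * l) `&` [set w | Q T w < D * l ^+ 2])) +
  fine (P (level (fun t w => -1 * N t w) (2 * l) `&` [set w | Q T w < D * l ^+ 2])))).
  rewrite -fineD ?fin_num_measure//; try exact: measurableI.
  apply: fine_le; rewrite ?fin_num_measure ?fin_numD//.
  - by apply: measurableU; exact: measurableI.
  - by rewrite !fin_num_measure//; exact: measurableI.
  - by apply: measureU2; exact: measurableI.
apply: lerD; [apply: h1|apply: h2]; rewrite ?mulr1 ?mulrNN ?mulr1// level_norm.
  exact: subsetUl.
exact: subsetUr.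
Qed.

End good_lambda.

(** * From the good-lambda inequality to moments *)

Section dyadic_moments.
Context {R : realType}.
Variables (p : R).
Hypothesis p0 : 0 < p.
Implicit Types (e x : R) (n i : nat).

Definition dyadic e i : R := e * 2 ^+ i.

Lemma dyadic_gt0 e i : 0 < e -> 0 < dyadic e i.
Proof. by move=> e0; rewrite mulr_gt0// exprn_gt0. Qed.

Lemma dyadicS e i : dyadic e i.+1 = 2 * dyadic e i.
Proof. by rewrite /dyadic exprS; ring. Qed.

Lemma dyadicS_powR e i : 0 < e ->
  dyadic e i.+1 `^ p = 2 `^ p * dyadic e i `^ p.
Proof. by move=> e0; rewrite dyadicS powRM// ltW// dyadic_gt0. Qed.

Lemma powR2_gt1 : 1 < 2 `^ p :> R.
Proof.
have := @gt0_ltr_powR _ p p0 1 2; rewrite !nnegrE ler01 ler0n powR1.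
by apply => //; rewrite ltr1n.
Qed.

(* The sum of the geometric series of ratio 2^{-p}. *)
Definition geometric_cst : R := (1 - (2 `^ p)^-1)^-1.

Lemma geometric_cst_gt0 : 0 < geometric_cst.
Proof. by rewrite invr_gt0 subr_gt0 invf_lt1 ?powR2_gt1// powR_gt0. Qed.

Lemma sum_dyadic_le e n : 0 < e ->
  \sum_(i < n.+1) dyadic e i `^ p <= geometric_cst * dyadic e n `^ p.
Proof.
move=> e0; have c0 := geometric_cst_gt0.
have pn0 : (2 `^ p : R) != 0 by rewrite gt_eqF// powR_gt0.
(* The fixed-point equation of the geometric series is exactly what the induction step consumes. *)
have cE : geometric_cst = geometric_cst * (2 `^ p)^-1 + 1.
  have h : 1 - (2 `^ p)^-1 != 0 :> R.
    by rewrite gt_eqF// subr_gt0 invf_lt1 ?powR2_gt1// powR_gt0.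
  rewrite -[X in _ = _ + X](mulVf h) -/geometric_cst -mulrDr addrC subrK.
  by rewrite mulr1.
elim: n => [|n IH].
  by rewrite big_ord1 ler_peMl ?powR_ge0// cE lerDr mulr_ge0 ?(ltW c0).
rewrite big_ord_recr/= [in leRHS]cE mulrDl mul1r lerD2r; apply: (le_trans IH).
by rewrite dyadicS_powR// mulrA mulfVK.
Qed.

(** If the top level is at most x, the whole sum is geometric and comparable to its last term, hence
    to x^p; otherwise the top term vanishes and the induction hypothesis applies. *)
Lemma sum_dyadic_indic_le e x n : 0 < e -> 0 <= x ->
  \sum_(i < n) dyadic e i `^ p * (dyadic e i <= x)%R%:R <= geometric_cst * x `^ p.
Proof.
move=> e0 x0; elim: n => [|n IH].
  by rewrite big_ord0 mulr_ge0 ?powR_ge0// ltW// geometric_cst_gt0.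
have [nx|nx] := leP (dyadic e n) x; last by rewrite big_ord_recr/= (lt_geF nx) mulr0 addr0.
apply: (@le_trans _ _ (\sum_(i < n.+1) dyadic e i `^ p)).
  by apply: ler_sum => i _; rewrite ler_piMr ?powR_ge0//; case: (dyadic e i <= x).
apply: (le_trans (sum_dyadic_le n e0)); rewrite ler_pM2l ?geometric_cst_gt0//.
by rewrite ge0_ler_powR// ?nnegrE// ltW// dyadic_gt0.
Qed.

(** The converse comparison. When x passes level n, the new term times 2^p is already the p-th power
    of the next level, so it alone dominates the left-hand side. The term e^p accounts for values of
    x below the first level. *)
Lemma powR_min_dyadic_le e x n : 0 < e -> 0 <= x ->
  Num.min x (dyadic e n) `^ p <=
  e `^ p + 2 `^ p * \sum_(i < n) dyadic e i `^ p * (dyadic e i <= x)%R%:R.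
Proof.
move=> e0 x0; have p0' := ltW p0.
have mono y z : 0 <= y -> y <= z -> y `^ p <= z `^ p.
  by move=> y0 yz; rewrite ge0_ler_powR// ?nnegrE// (le_trans y0).
have d0 m : 0 <= dyadic e m by rewrite ltW// dyadic_gt0.
elim: n => [|n IH].
  rewrite big_ord0 mulr0 addr0 {1}/dyadic expr0 mulr1; apply: mono.
    by rewrite le_min x0 ltW.
  by rewrite ge_min lexx orbT.
rewrite big_ord_recr/=; have [nx|nx] := leP (dyadic e n) x.
  rewrite mulr1 mulrDr -dyadicS_powR// addrA -[leLHS]add0r; apply: lerD.
    rewrite addr_ge0 ?powR_ge0// mulr_ge0 ?powR_ge0//; apply: sumr_ge0 => i _.
    by rewrite mulr_ge0 ?powR_ge0.
  by apply: mono; rewrite ?le_min ?x0 ?d0// ge_min lexx orbT.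
rewrite mulr0 addr0; apply: le_trans IH; apply: mono; first by rewrite le_min x0 d0.
rewrite le_min ge_min lexx /= ge_min; apply/orP; left; exact: ltW.
Qed.

End dyadic_moments.

Section good_lambda_moments.
Context {d : measure_display} {Omega : measurableType d} {R : realType}.
Variables (P : probability Omega R) (p : R).
Hypothesis p0 : 0 < p.

Lemma integral_sum_indic (n : nat) (r : nat -> R) (A : nat -> set Omega) :
  (forall i, 0 <= r i) -> (forall i, measurable (A i)) ->
  (\int[P]_w (\sum_(i < n) r i * \1_(A i) w)%:E =
   (\sum_(i < n) r i * fine (P (A i)))%:E)%E.
Proof.
move=> r0 mA; under eq_integral do rewrite -sumEFin.
rewrite ge0_integral_sum//; first last.
- by move=> i w _; rewrite lee_fin mulr_ge0.
- by move=> i; apply/measurable_EFinP/measurable_funM => //; exact: measurable_indic.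
rewrite -sumEFin; apply: eq_bigr => i _.
under eq_integral do rewrite EFinM.
rewrite ge0_integralZl_EFin//; last by apply/measurable_EFinP; exact: measurable_indic.
by rewrite integral_indic// setIT EFinM fineK// fin_num_measure.
Qed.

(* Chosen so that 2^p times the constant 2 D of the good-lambda inequality
   equals 1/2. *)
Definition good_lambda_ratio : R := (2 `^ (p + 2))^-1.

Lemma good_lambda_ratio_gt0 : 0 < good_lambda_ratio.
Proof. by rewrite invr_gt0 powR_gt0. Qed.

Lemma good_lambda_ratioE : 2 `^ p * (2 * good_lambda_ratio) = 2^-1.
Proof.
rewrite /good_lambda_ratio powRD ?(implyTb, oner_eq0) ?pnatr_eq0 ?implybT//.
rewrite (powR_mulrn 2 (ler0n _ 2)).
have : (2 `^ p : R) != 0 by rewrite gt_eqF// powR_gt0.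
by move=> h; field.
Qed.

(** The factors are the losses in order: 2^p from comparing S^p with its dyadic sum, 2 from
    absorbing half of that sum, 2^p from doubling the level, [geometric_cst] from summing the levels
    below a given value, and the last one from the scaling D l^2 <= x. *)
Definition good_lambda_cst : R :=
  2 `^ p * (2 * 2 `^ p) * (geometric_cst p * (good_lambda_ratio^-1) `^ (p / 2)).

Lemma good_lambda_cst_gt0 : 0 < good_lambda_cst.
Proof.
by rewrite !mulr_gt0 ?powR_gt0 ?geometric_cst_gt0 ?invr_gt0 ?good_lambda_ratio_gt0.
Qed.

Variables (S x : Omega -> R).
Hypotheses (mS : measurable_fun setT S) (mx : measurable_fun setT x).
Hypotheses (S0 : forall w, 0 <= S w) (x0 : forall w, 0 <= x w).
Hypothesis GL : forall l, 0 < l ->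
  fine (P ([set w | 2 * l <= S w] `&` [set w | x w < good_lambda_ratio * l ^+ 2])) <=
  2 * good_lambda_ratio * fine (P [set w | l <= S w]).

Let mSl l : measurable [set w | l <= S w].
Proof.
have := mS measurableT (measurable_itv `[l, +oo[).
by rewrite setTI; congr measurable; apply/seteqP; split => w /=; rewrite in_itv/= andbT.
Qed.

Let mxl l : measurable [set w | l <= x w].
Proof.
have := mx measurableT (measurable_itv `[l, +oo[).
by rewrite setTI; congr measurable; apply/seteqP; split => w /=; rewrite in_itv/= andbT.
Qed.

Let mxl' l : measurable [set w | x w < l].
Proof.
have := mx measurableT (measurable_itv `]-oo, l[).
by rewrite setTI; congr measurable; apply/seteqP; split => w /=; rewrite in_itv.
Qed.

Let prS e i := fine (P [set w | dyadic e i <= S w]).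
Let prx e i := fine (P [set w | good_lambda_ratio * dyadic e i ^+ 2 <= x w]).

Let pr_step e i : 0 < e -> prS e i.+1 <= 2 * good_lambda_ratio * prS e i + prx e i.
Proof.
move=> e0; have l0 := dyadic_gt0 i e0; apply: (@le_trans _ _ (fine (P
  ([set w | 2 * dyadic e i <= S w] `&` [set w | x w < good_lambda_ratio * dyadic e i ^+ 2]))
  + prx e i)); last by rewrite lerD2r GL.
rewrite /prx -fineD ?fin_num_measure//; last exact: measurableI.
apply: fine_le; rewrite ?fin_numD ?fin_num_measure//; first exact: measurableI.
rewrite dyadicS; apply: le_trans (measureU2 _ _ _) => //; last exact: measurableI.
apply: le_measure; rewrite ?inE//; first by apply: measurableU => //; exact: measurableI.
move=> w /= lS; have [xl|xl] := ltP (x w) (good_lambda_ratio * dyadic e i ^+ 2).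
  by left.
by right.
Qed.

(** After shifting the index by one, term 0 costs at most e^p and [pr_step] bounds each later term
    by half of its predecessor plus a term in [prx], thanks to [good_lambda_ratioE]. Half of [A] can
    then be subtracted because [A] is a finite sum of real numbers. *)
Let sum_step e n : 0 < e ->
  \sum_(i < n) dyadic e i `^ p * prS e i <=
  2 * e `^ p + 2 * 2 `^ p * \sum_(i < n) dyadic e i `^ p * prx e i.
Proof.
move=> e0; set A := \sum_(i < n) _.
have pr0 i : 0 <= prS e i by exact: fine_ge0.
have : A <= \sum_(i < n.+1) dyadic e i `^ p * prS e i.
  by rewrite big_ord_recr/= lerDl mulr_ge0 ?powR_ge0.
rewrite big_ord_recl/= => AA.
have a0 : dyadic e 0 `^ p * prS e 0%N <= e `^ p.
  rewrite /dyadic expr0 mulr1 ler_piMr ?powR_ge0// -lee_fin fineK ?fin_num_measure//.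
  exact: probability_le1.
have : \sum_(i < n) dyadic e i.+1 `^ p * prS e i.+1 <=
    2^-1 * A + 2 `^ p * \sum_(i < n) dyadic e i `^ p * prx e i.
  rewrite !mulr_sumr -big_split/=; apply: ler_sum => i _.
  rewrite dyadicS_powR// -good_lambda_ratioE.
  rewrite [leRHS](_ : _ = 2 `^ p * dyadic e i `^ p * (2 * good_lambda_ratio * prS e i + prx e i)).
    by rewrite ler_wpM2l ?mulr_ge0 ?powR_ge0// pr_step.
  by ring.
by move: AA a0; set B := \sum_(i < n) _; set C := \sum_(i < n) _; lra.
Qed.

Let integral_prx e n : 0 < e ->
  ((\sum_(i < n) dyadic e i `^ p * prx e i)%:E <=
  (geometric_cst p * (good_lambda_ratio^-1) `^ (p / 2))%:E * \int[P]_w ((x w) `^ (p / 2))%:E)%E.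
Proof.
move=> e0; rewrite -(@integral_sum_indic n (fun i => dyadic e i `^ p)
   (fun i => [set w | good_lambda_ratio * dyadic e i ^+ 2 <= x w])); last 2 first.
- by move=> i; exact: powR_ge0.
- by move=> i; exact: mxl.
rewrite -ge0_integralZl_EFin//; last 3 first.
- by move=> w _; rewrite lee_fin powR_ge0.
- by apply/measurable_EFinP; apply: (measurableT_comp (measurable_powR _)) => //.
- by rewrite mulr_ge0 ?powR_ge0// ltW// geometric_cst_gt0.
apply: ge0_le_integral => //.
- by move=> w _; rewrite lee_fin; apply: sumr_ge0 => i _; rewrite mulr_ge0 ?powR_ge0.
- apply/measurable_EFinP; apply: measurable_sum => i.
  by apply: measurable_funM => //; exact: measurable_indic.
- apply/measurable_EFinP; apply: measurable_funM => //.
  by apply: (measurableT_comp (measurable_powR _)).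
move=> w _; rewrite -EFinM lee_fin.
(* The condition D l^2 <= x reads l <= y, and y^p is D^(-p/2) x^(p/2). *)
pose y := Num.sqrt (x w / good_lambda_ratio).
have g0 := good_lambda_ratio_gt0.
have y2 : y ^+ 2 = x w / good_lambda_ratio by rewrite sqr_sqrtr// divr_ge0// ltW.
have yp : y `^ p = (good_lambda_ratio^-1) `^ (p / 2) * x w `^ (p / 2).
  rewrite -powRM ?invr_ge0 ?(ltW g0)// [_^-1 * _]mulrC -y2 -powR_mulrn ?sqrtr_ge0//.
  by rewrite -powRrM mulrCA mulfV ?mulr1.
rewrite -mulrA -yp; apply: le_trans (sum_dyadic_indic_le p0 n e0 (sqrtr_ge0 _)).
apply: ler_sum => i _; rewrite indicE ler_wpM2l ?powR_ge0// ler_nat.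
have -> // : (w \in [set w | good_lambda_ratio * dyadic e i ^+ 2 <= x w]) = (dyadic e i <= y).
rewrite (_ : (w \in _) = (good_lambda_ratio * dyadic e i ^+ 2 <= x w)); last first.
  by apply/idP/idP; rewrite inE.
rewrite mulrC -ler_pdivlMr// -y2 ler_pXn2r// nnegrE ?sqrtr_ge0// ltW//.
exact: dyadic_gt0.
Qed.

Lemma good_lambda_moment_le :
  (\int[P]_w ((S w) `^ p)%:E <= good_lambda_cst%:E * \int[P]_w ((x w) `^ (p / 2))%:E)%E.
Proof.
(* The lowest level [e] contributes e^p through [powR_min_dyadic_le] and 2^p times 2 e^p through
   [sum_step]; [e] is chosen so that the total k e^p is the allowed error r. *)
apply/lee_addgt0Pr => r r0; pose k := 1 + 2 `^ p * 2 : R.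
have k0 : 0 < k by rewrite addr_gt0// mulr_gt0// powR_gt0.
pose e := (r / k) `^ p^-1.
have e0 : 0 < e by rewrite powR_gt0// divr_gt0.
have ep : k * e `^ p = r.
  by rewrite -powRrM mulVf ?gt_eqF// powRr1 ?divr_ge0 ?ltW// mulrC divfK// gt_eqF.
have min_le n : (\int[P]_w (Num.min (S w) (dyadic e n) `^ p)%:E <=
    good_lambda_cst%:E * \int[P]_w ((x w) `^ (p / 2))%:E + r%:E)%E.
  apply: (@le_trans _ _ (\int[P]_w (e `^ p + 2 `^ p *
     \sum_(i < n) dyadic e i `^ p * \1_([set w | dyadic e i <= S w]) w)%:E)%E).
    apply: ge0_le_integral => //.
    - by move=> w _; rewrite lee_fin powR_ge0.
    - apply/measurable_EFinP; apply: (measurableT_comp (measurable_powR _)) => //.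
      exact: measurable_minr.
    - apply/measurable_EFinP; apply: measurable_funD => //; apply: measurable_funM => //.
      apply: measurable_sum => i.
      by apply: measurable_funM => //; exact: measurable_indic.
    - move=> w _; rewrite lee_fin.
      apply: (le_trans (powR_min_dyadic_le p0 n e0 (S0 w))).
      rewrite lerD2l ler_pM2l ?powR_gt0//; apply: ler_sum => i _.
      rewrite indicE ler_wpM2l ?powR_ge0// ler_nat.
      by have [lS|//] := leP (dyadic e i) (S w); rewrite mem_set.
  pose q := \sum_(i < n) dyadic e i `^ p * prx e i.
  have q_ge0 : 0 <= q by apply: sumr_ge0 => i _; rewrite mulr_ge0 ?powR_ge0// fine_ge0.
  have -> : (\int[P]_w (e `^ p + 2 `^ p *
     \sum_(i < n) dyadic e i `^ p * \1_([set w | dyadic e i <= S w]) w)%:E =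
     (e `^ p + 2 `^ p * \sum_(i < n) dyadic e i `^ p * prS e i)%:E)%E.
    have msum : measurable_fun setT (fun w => \sum_(i < n) dyadic e i `^ p *
        \1_([set w | dyadic e i <= S w]) w : R).
      apply: measurable_sum => i.
      by apply: measurable_funM => //; exact: measurable_indic.
    have sum0 w : 0 <= \sum_(i < n) dyadic e i `^ p *
        \1_([set w | dyadic e i <= S w]) w :> R.
      by apply: sumr_ge0 => i _; rewrite mulr_ge0 ?powR_ge0.
    under eq_integral do rewrite EFinD EFinM.
    rewrite ge0_integralD//; last 3 first.
    - by move=> w _; rewrite lee_fin powR_ge0.
    - by move=> w _; rewrite -EFinM lee_fin mulr_ge0// powR_ge0.
    - apply: measurable_funeM; exact/measurable_EFinP.
    rewrite ge0_integralZl_EFin ?powR_ge0//; last 2 first.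
    - by move=> w _; rewrite lee_fin.
    - exact/measurable_EFinP.
    rewrite (@integral_sum_indic n (fun i => dyadic e i `^ p)
      (fun i => [set w | dyadic e i <= S w]))//; last by move=> i; exact: powR_ge0.
    rewrite integral_cst// [X in (_ * X + _)%E](_ : _ = 1%E).
      by rewrite mule1 EFinD EFinM.
    exact: (probability_setT P).
  apply: (@le_trans _ _ ((k * e `^ p)%:E + (2 `^ p * (2 * 2 `^ p) * q)%:E)%E).
    rewrite -EFinD lee_fin.
    rewrite (_ : _ + _ * q = e `^ p + 2 `^ p * (2 * e `^ p + 2 * 2 `^ p * q)).
      by rewrite lerD2l ler_pM2l ?powR_gt0// sum_step.
    by rewrite /k; ring.
  rewrite ep addeC leeD2r// /good_lambda_cst [X in (X <= _)%E]EFinM.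
  rewrite [X in (_ <= X * _)%E]EFinM -muleA; apply: lee_wpmul2l; first by rewrite lee_fin !mulr_ge0 ?powR_ge0.
  exact: integral_prx.
have cvgS : (\int[P]_w (Num.min (S w) (dyadic e n) `^ p)%:E)%E @[n --> \oo] -->
    (\int[P]_w (S w `^ p)%:E)%E.
  have cvgw w : (Num.min (S w) (dyadic e n) `^ p)%:E @[n --> \oo] --> (S w `^ p)%:E.
    (* Since 2^n > n, the cut lies above [S w] as soon as n exceeds S w / e. *)
    apply: cvg_near_cst; exists (Num.trunc (S w / e)).+1 => // n /= nS.
    rewrite min_l// /dyadic mulrC -ler_pdivrMr//.
    apply: (le_trans (ltW (truncnS_gt _))).
    by apply: (@le_trans _ _ n%:R); rewrite ?ler_nat// -natrX ler_nat ltnW// ltn_expl.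
  have -> : (\int[P]_w (S w `^ p)%:E = \int[P]_w limn
      (fun n => (Num.min (S w) (dyadic e n) `^ p)%:E))%E.
    by apply: eq_integral => w _; apply/esym/cvg_lim => //; exact: cvgw.
  apply: cvg_monotone_convergence => //.
  - move=> n; apply/measurable_EFinP; apply: (measurableT_comp (measurable_powR _)) => //.
    exact: measurable_minr.
  - by move=> n w _; rewrite lee_fin powR_ge0.
  - move=> w _ m n mn; rewrite lee_fin.
    have d0 i : 0 <= dyadic e i by exact/ltW/dyadic_gt0.
    apply: ge0_ler_powR; rewrite ?nnegrE; [exact: ltW| | |].
    + by rewrite le_min S0 d0.
    + by rewrite le_min S0 d0.
    rewrite le_min ge_min lexx /= ge_min; apply/orP; right.
    by rewrite /dyadic ler_pM2l// ler_weXn2l// ler1n.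
by apply: (cvge_le _ cvgS); apply: nearW => n; exact: min_le.
Qed.

End good_lambda_moments.

(** * The running supremum *)

Section running_sup.
Context {d : measure_display} {Omega : measurableType d} {R : realType}.
Variables (T : R) (X : R -> Omega -> R).
Hypotheses (T0 : 0 <= T) (cX : continuous_process T X).

Lemma running_sup_attained w : exists c, [/\ 0 <= c <= T,
  running_sup T X w = `|X c w|%:E & forall t, 0 <= t <= T -> `|X t w| <= `|X c w|].
Proof.
have cn : {within `[0, T], continuous (fun t => `|X t w|)}.
  apply: (@within_continuous_eq _ _ (fun t => `|X (clamp T t) w|)).
    have cc := (continuous_process_clamp X T0).1 cX w.
    move=> t; apply: (@continuous_comp _ _ _ (fun t => X (clamp T t) w)).
      exact: cc.
    exact: norm_continuous.
  by move=> t tT; rewrite clamp_id.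
have [c] := EVT_max T0 cn; rewrite in_itv /= => cT cmax.
have cmax' t : 0 <= t <= T -> `|X t w| <= `|X c w|.
  by move=> tT; apply: cmax; rewrite in_itv.
exists c; split => //; apply/eqP; rewrite eq_le; apply/andP; split.
  by apply: ge_ereal_sup => _ [t + <-]; rewrite /= in_itv /= lee_fin => /cmax'.
by apply: ereal_sup_ubound; exists c => //=; rewrite in_itv.
Qed.

Lemma running_sup_fin w : running_sup T X w = (fine (running_sup T X w))%:E.
Proof. by have [c [_ -> _]] := running_sup_attained w. Qed.

Lemma le_running_sup t w : 0 <= t <= T -> `|X t w| <= fine (running_sup T X w).
Proof. by have [c [_ -> H]] := running_sup_attained w; exact: H. Qed.

Lemma fine_running_sup_ge0 w : 0 <= fine (running_sup T X w).
Proof. by have [c [_ -> H]] := running_sup_attained w => /=. Qed.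

Lemma running_sup_level (l : R) :
  [set w | l <= fine (running_sup T X w)] = level T (fun t w => `|X t w|) l.
Proof.
apply/seteqP; split => w /=; have [c [cT -> H]] := running_sup_attained w => /=.
  by exists c.
by move=> [t [tT lX]]; apply: (le_trans lX); exact: H.
Qed.

Lemma measurable_running_sup :
  (forall t, 0 <= t <= T -> measurable_fun setT (X t)) ->
  measurable_fun setT (fun w => fine (running_sup T X w)).
Proof.
move=> mX; apply: (measurability _ (RGenCInfty.measurableE R)) => //=.
move=> _ [_ [x ->] <-]; rewrite setTI.
rewrite (_ : _ @^-1` _ = [set w | x <= fine (running_sup T X w)]); last first.
  by apply/seteqP; split => w /=; rewrite in_itv /= andbT.
rewrite running_sup_level.
(* The result for adapted processes is reused with the constant filtration of all measurable
   sets. *)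
apply: (@level_measurable _ _ _ (fun=> measurable) T) => //.
- split=> [t _|t _ A|s t _ _ A]; [|by []|by []].
  split=> [|A mA|A mA]; [exact: measurable0|exact: measurableD|].
  exact: bigcupT_measurable.
- move=> t tT B mB; rewrite -[_ @^-1` _]setTI.
  by apply: (measurableT_comp (@normr_measurable _ _) (mX _ tT)).
- move=> w; apply: (@within_continuous_eq _ _ (fun t => `|X (clamp T t) w|)).
    have cc := (continuous_process_clamp X T0).1 cX w.
    move=> t; apply: (@continuous_comp _ _ _ (fun t => X (clamp T t) w)).
      exact: cc.
    exact: norm_continuous.
  by move=> t tT; rewrite clamp_id.
Qed.

End running_sup.

Lemma running_sup_moment_le {d : measure_display} {Omega : measurableType d}
    {R : realType} (P : probability Omega R) (F : R -> set (set Omega))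
    (T p : R) (M Q : R -> Omega -> R) :
  filtration F -> 0 <= T -> 0 < p -> local_martingale P F T M ->
  continuous_process T M -> is_quadratic_variation P F T M Q ->
  (\int[P]_w (fine (running_sup T (fun t w => (M t w - M 0 w)%R) w) `^ p)%:E <=
   (good_lambda_cst p)%:E * \int[P]_w ((Q T w `^ (p / 2))%R)%:E)%E.
Proof.
move=> FF T0 p0 lM cM QV; have [aM _] := lM; have [aQ _ Q0 ndQ _] := QV.
have cN := continuous_increment T0 cM.
have mM t : 0 <= t <= T -> measurable_fun setT (M t).
  by move=> tT; apply: (measurable_for_fun FF _ (aM t tT)); case/andP: tT.
apply: good_lambda_moment_le => //.
- apply: measurable_running_sup => // t tT; apply: measurable_funB; apply: mM => //.
  by rewrite lexx.
- by apply: (measurable_for_fun FF T0 (aQ T _)); rewrite T0 lexx.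
- by move=> w; exact: fine_running_sup_ge0.
- by move=> w; rewrite -(Q0 w) ndQ.
- move=> l l0; rewrite !running_sup_level//.
  by apply: (good_lambda FF T0 lM cM QV l0); exact: good_lambda_ratio_gt0.
Qed.

(** * The pathwise bound *)

Section time_integral.
Context {d : measure_display} {Omega : measurableType d} {R : realType}.
Variables (F : R -> set (set Omega)) (T : R) (V : R -> Omega -> R).
Hypotheses (FF : filtration F) (T0 : 0 <= T).
Hypotheses (aV : adapted F T V) (cV : continuous_process T V).
Hypothesis V_le0 : forall t w, 0 <= t <= T -> V t w <= 0.

Lemma time_integral0 w : time_integral V 0 w = 0.
Proof. by rewrite /time_integral set_itv1 Rintegral_set1. Qed.

Let iV (t : R) (w : Omega) : 0 <= t <= T ->
  (@lebesgue_measure R).-integrable `[0, t] (EFin \o (fun t => V t w)).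
Proof.
move=> /andP[t0 tT].
have cVt : {within `[0, t], continuous (fun t => V t w)}.
  by apply: continuous_subspaceW (@cV w); apply: subset_itvl; rewrite bnd_simp.
by apply: continuous_compact_integrable; [exact: segment_compact|exact: cVt].
Qed.

Lemma time_integral_increment s t w (c : R) : 0 <= s -> s <= t -> t <= T ->
  (forall r, 0 <= r <= T -> `|V r w| <= c) ->
  0 <= time_integral V s w - time_integral V t w <= c * (t - s).
Proof.
move=> s0 st tT Vc; have t0 := le_trans s0 st.
have sub : `]s, t] `<=` `[0, t].
  by apply: subset_itvr; rewrite bnd_simp.
have iV' : (@lebesgue_measure R).-integrable `]s, t] (EFin \o (fun t => V t w)).
  have it : (@lebesgue_measure R).-integrable `[0, t] (EFin \o (fun t => V t w)).
    by apply: iV; rewrite t0.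
  by apply: integrableS it.
rewrite -opprB /time_integral Rintegral_itvB ?bnd_simp//; last by apply: iV; rewrite t0.
have itvT r : `]s, t]%classic r -> 0 <= r <= T.
  rewrite /= in_itv /= => /andP[sr rt].
  by rewrite (le_trans s0 (ltW sr)) (le_trans rt tT).
have icst (k : R) : (@lebesgue_measure R).-integrable `]s, t] (EFin \o cst k).
  have it : (@lebesgue_measure R).-integrable `[0, t] (EFin \o cst k).
    apply: continuous_compact_integrable; first exact: segment_compact.
    by apply: continuous_subspaceT => x; exact: cst_continuous.
  by apply: integrableS it.
rewrite oppr_ge0; apply/andP; split.
  rewrite -[leRHS](mul0r (fine (lebesgue_measure `]s, t]%classic))).
  rewrite -Rintegral_cst//; apply: (le_Rintegral _ iV' (icst 0)) => // r /itvT rT.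
  exact: V_le0.
rewrite lerNl -mulNr.
have -> : t - s = fine (lebesgue_measure `]s, t]%classic).
  rewrite lebesgue_measure_itv/= lte_fin; move: st; rewrite le_eqVlt => /predU1P[->|->//].
  by rewrite ltxx subrr.
rewrite -Rintegral_cst//; apply: (le_Rintegral _ (icst (- c)) iV') => // r /itvT rT.
by have := Vc _ rT; rewrite ler_norml => /andP[].
Qed.

(** By progressive measurability the integrand is jointly measurable for [F t] and the Borel sets,
    so Tonelli's theorem makes the integral [F t]-measurable. It is applied to -V, which is
    nonnegative. *)
Lemma time_integral_adapted : adapted F T (time_integral V).
Proof.
move=> t tT; have [sF _ _] := FF; have /andP[t0 _] := tT.
apply/measurable_forP; first exact: sF.
pose f (z : g_sigma_algebraType (F t) * R) : \bar R :=
  (- V (clamp t z.2) z.1 * \1_(`[0, t]%classic : set R) z.2)%:E.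
have mf : measurable_fun setT f.
  apply/measurable_EFinP/measurable_funM.
    apply: measurableT_comp => //; exact: (progressively_measurable FF tT aV cV).
  have mI : measurable_fun setT (\1_(`[0, t]%classic : set R) : R -> R).
    exact: measurable_indic.
  exact: (measurableT_comp mI measurable_snd).
have f0 z : (0 <= f z)%E.
  rewrite lee_fin mulr_ge0// oppr_ge0 V_le0//.
  have /andP[-> ct] := clamp_itv z.2 t0; rewrite (le_trans ct)//.
  by case/andP: tT.
have mF := @measurable_fun_fubini_tonelli_F _ _ _ _ _ lebesgue_measure f mf f0.
rewrite (_ : time_integral V t =
    fun w : g_sigma_algebraType (F t) => - fine (fubini_F lebesgue_measure f w)).
  by apply: measurableT_comp => //; apply: measurableT_comp.
apply/funext => w; rewrite /time_integral /Rintegral -fineN; congr fine.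
rewrite /fubini_F -integral_ge0N//.
rewrite integral_mkcond; apply: eq_integral => s _; rewrite epatch_indic.
change ((V s w * \1_(`[0, t]%classic : set R) s)%:E =
  (- (- V (clamp t s) w * \1_(`[0, t]%classic : set R) s))%:E).
congr EFin; rewrite mulNr opprK indicE.
have [/set_mem|_] := boolP (s \in _); last by rewrite !mulr0.
by rewrite /= in_itv /= => sT; rewrite clamp_id.
Qed.

End time_integral.

Lemma abel_bound {R : realType} (c m : nat -> R) (n : nat) (B : R) :
  0 <= c 0%N -> {homo c : i j / (i <= j)%N >-> i <= j} -> m 0%N = 0 ->
  (forall i, `|m i| <= B) ->
  `|\sum_(i < n) c i * (m i.+1 - m i)| <= 2 * c n * B.
Proof.
move=> c0 cm m0 mB.
have cn i : 0 <= c i by rewrite (le_trans c0)// cm.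
(* The boundary term is moved to the left to make the induction close: the error grows by (c_{k+1} -
   c_k) B at each step, which telescopes. The boundary term itself accounts for the factor 2. *)
have H k : `|\sum_(i < k) c i * (m i.+1 - m i) - c k * m k| <= c k * B.
  elim: k => [|k IH].
    by rewrite big_ord0 m0 mulr0 subrr normr0 mulr_ge0// (le_trans _ (mB 0%N)).
  rewrite big_ord_recr/= [X in `|X|](_ : _ =
    (\sum_(i < k) c i * (m i.+1 - m i) - c k * m k) - (c k.+1 - c k) * m k.+1).
    apply: (le_trans (ler_normB _ _)).
    rewrite [leRHS](_ : _ = c k * B + (c k.+1 - c k) * B); last by ring.
    apply: lerD => //; rewrite normrM ger0_norm ?subr_ge0 ?cm//.
    by rewrite ler_wpM2l ?subr_ge0 ?cm.
  by ring.
rewrite -(subrK (c n * m n) (\sum_(i < n) _)) (le_trans (ler_normD _ _))//.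
rewrite [leRHS](_ : _ = c n * B + c n * B); last by ring.
by apply: lerD => //; rewrite normrM ger0_norm// ler_wpM2l.
Qed.

Lemma sum_single_indic {R : realType} (n : nat) (c : nat -> R) (b : nat -> bool) j :
  (j < n)%N -> b j -> (forall i, i != j -> ~~ b i) ->
  \sum_(i < n) c i * (b i)%:R = c j.
Proof.
move=> jn bj nb; rewrite (bigD1 (Ordinal jn))//= bj mulr1 big1 ?addr0// => i ij.
by rewrite (negbTE (nb _ _)) ?mulr0.
Qed.

(** * Step approximations of the exponential integrand *)

Section integrand.
Context {d : measure_display} {Omega : measurableType d} {R : realType}.
Variables (P : probability Omega R) (F : R -> set (set Omega)) (T : R).
Variable V : R -> Omega -> R.
Hypotheses (FF : filtration F) (T0 : 0 <= T).
Hypotheses (aV : adapted F T V) (cV : continuous_process T V).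
Hypothesis V_le0 : forall t w, 0 <= t <= T -> V t w <= 0.

Definition expV t w : R := expR (- time_integral V t w).

Lemma expV0 w : expV 0 w = 1.
Proof. by rewrite /expV time_integral0 oppr0 expR0. Qed.

Let V_bounded w : exists c, 0 <= c /\ forall r, 0 <= r <= T -> `|V r w| <= c.
Proof.
have [c [_ _ H]] := running_sup_attained T0 cV w.
by exists `|V c w|.
Qed.

Lemma expV_le s t w : 0 <= s -> s <= t -> t <= T -> expV s w <= expV t w.
Proof.
move=> s0 st tT; have [c [c0 Vc]] := V_bounded w.
have /andP[+ _] := time_integral_increment cV V_le0 s0 st tT Vc.
by rewrite subr_ge0 => H; rewrite ler_expR lerN2.
Qed.

(** This is 1 - exp(-x) <= x, with x the increment of the time integral; the constant depends on the
    path. *)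
Lemma expV_lipschitz w : exists L, 0 <= L /\ forall s t, 0 <= s -> s <= t ->
  t <= T -> expV t w - expV s w <= L * (t - s).
Proof.
have [c [c0 Vc]] := V_bounded w; exists (expV T w * c).
split=> [|s t s0 st tT]; first by rewrite mulr_ge0// expR_ge0.
have /andP[d0 dc] := time_integral_increment cV V_le0 s0 st tT Vc.
set x := _ - _ in d0 dc.
have -> : expV s w = expV t w * expR (- x).
  by rewrite /expV -expRD; congr expR; rewrite /x; ring.
apply: (@le_trans _ _ (expV t w * x)).
  rewrite -[X in X - _]mulr1 -mulrBr ler_pM2l ?expR_gt0// lerBlDr -lerBlDl.
  by have := expR_ge1Dx (- x).
rewrite -mulrA; apply: ler_pM; [exact: expR_ge0|exact: d0| |exact: dc].
by apply: expV_le => //; exact: le_trans st.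
Qed.

Lemma expV_adapted : adapted F T expV.
Proof.
move=> t tT; have [sF _ _] := FF; have /andP[t0 _] := tT.
apply/measurable_forP; first exact: sF.
apply: measurableT_comp => //; apply: measurableT_comp => //.
apply/measurable_forP; first exact: sF.
exact: (time_integral_adapted FF aV cV V_le0).
Qed.

Let g n i := clamp T (gridpt n i) : R.
Let sz n := gridindex n T.

Let g_itv n i : 0 <= g n i <= T. Proof. exact: clamp_itv. Qed.
Let g_ge0 n i : 0 <= g n i. Proof. by have /andP[] := g_itv n i. Qed.
Let g_leT n i : g n i <= T. Proof. by have /andP[] := g_itv n i. Qed.
Let gE n i : g n i = Num.min T (gridpt n i).
Proof. by rewrite /g clamp_min// gridpt_ge0. Qed.
Let g0 n : g n 0 = 0. Proof. by rewrite gE gridpt0 min_r. Qed.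
Let g_le n i j : (i <= j)%N -> g n i <= g n j.
Proof. by move=> ij; rewrite !gE le_min !ge_min lexx/= (le_gridpt _ ij) orbT. Qed.
Let g_step n i : g n i.+1 - g n i <= n.+1%:R^-1.
Proof.
rewrite !gE gridptS lerBlDr; have [Tg|gT] := leP T (gridpt n i).
  by rewrite ge_min lerDr invr_ge0 ler0n.
by rewrite ge_min addrC lexx orbT.
Qed.

(** Left-endpoint steps at deterministic times. The grid is clamped to end exactly at T, and the
    coefficient 1 at time 0 is the value [expV 0], so that the approximation is exact there. *)
Definition step_expV n : simple_process :=
  SimpleProcess (sz n) (fun=> 1) (fun i _ => g n i) (fun i w => expV (g n i) w).

Lemma step_expV_predictable n : simple_predictable F (step_expV n).
Proof.
have [sF mF incF] := FF.
have cstF t (Q : Prop) : 0 <= t -> F t [set _ | Q].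
  move=> t0; rewrite -(measurable_g_measurableTypeE (sF _ t0)).
  have [q|q] := pselect Q.
    by rewrite (_ : mkset _ = setT)//; apply/seteqP; split.
  by rewrite (_ : mkset _ = set0)//; apply/seteqP; split.
split=> /=.
- by move=> B mB; exact: cstF.
- by move=> i _; split=> [w|t t0]; [exact: g_ge0|exact: cstF].
- by move=> i w _; exact: g_le.
- move=> i _ B mB; have FB : F (g n i) (expV (g n i) @^-1` B).
    by apply: expV_adapted => //; exact: g_itv.
  split=> [|t t0]; first by apply: mF FB.
  have [gt|gt] := boolP (g n i <= t).
    rewrite (_ : mkset _ = setT) ?setIT; first by apply: (incF (g n i) t) FB.
    by apply/seteqP; split.
  rewrite (_ : mkset _ = set0) ?setI0; last by apply/seteqP; split => // w /=; rewrite (negbTE gt).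
  by have [] := sF _ t0.
Qed.

Let step_cell n t w j : (j < sz n)%N -> g n j < t <= g n j.+1 ->
  simple_value (step_expV n) t w = expV (g n j) w.
Proof.
move=> jn /andP[gt tg]; rewrite /simple_value /=.
have t0 : 0 < t by rewrite (le_lt_trans _ gt).
rewrite (gt_eqF t0) mulr0 add0r.
apply: (@sum_single_indic _ (sz n) (fun i => expV (g n i) w)
  (fun i => g n i < t <= g n i.+1)) => //; first by rewrite gt.
move=> i ij; apply/negP => /andP[gi tgi].
move: ij; rewrite neq_ltn => /orP[ij|ji].
  by have := le_lt_trans (g_le n ij) gt; rewrite ltNge tgi.
by have := le_lt_trans (g_le n ji) gi; rewrite ltNge tg.
Qed.

Let step_at0 n w : simple_value (step_expV n) 0 w = 1.
Proof.
rewrite /simple_value /= eqxx mulr1 big1 ?addr0// => i _.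
by rewrite ltNge g_ge0/= mulr0.
Qed.

(* Since expV is nondecreasing, the supremum over a cell is attained at its right
   endpoint, which makes the event below a finite union of measurable sets. *)
Let jump n eps : set Omega := \bigcup_(i in [set i | (i < sz n)%N])
  [set w | eps < expV (g n i.+1) w - expV (g n i) w].

Let step_event n eps : 0 < eps -> [set w | (eps%:E <
    running_sup T (fun t w => (simple_value (step_expV n) t w - expV t w)%R) w)%E] =
  jump n eps.
Proof.
move=> eps0; apply/seteqP; split => w /=.
  move=> /ereal_sup_gt[_ [t + <-]]; rewrite /= in_itv/= lte_fin => /andP[t0 tT].
  move: t0; rewrite le_eqVlt => /predU1P[<-|t0].
    by rewrite step_at0 expV0 subrr normr0 ltNge ltW.
  (* A time t > 0 lies in the cell ]g_j, g_{j+1}] where j + 1 is its grid index. *)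
  have : (0 < gridindex n t)%N by rewrite ltnNge gridindex_le ?(ltW t0)// gridpt0 -ltNge.
  case jE : (gridindex n t) => [//|j] _.
  have gj : g n j < t.
    rewrite gE gt_min; apply/orP; right.
    by rewrite ltNge -gridindex_le ?(ltW t0)// jE ltnn.
  have tg : t <= g n j.+1.
    by rewrite gE le_min tT -jE gridindex_ge// ltW.
  have jn : (j < sz n)%N.
    by rewrite -jE gridindex_le ?(ltW t0)// (le_trans tT)// /sz gridindex_ge.
  rewrite (step_cell _ jn) ?gj// distrC ger0_norm ?subr_ge0; last first.
    by apply: expV_le => //; exact: ltW.
  move=> /lt_le_trans lt_eps; exists j => //=; apply: lt_eps.
  by rewrite lerD2r; apply: expV_le => //; exact: ltW.
move=> [i /= ni lt_eps].
apply: (@lt_le_trans _ _ (expV (g n i.+1) w - expV (g n i) w)%:E).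
  by rewrite lte_fin.
apply: ereal_sup_ubound; exists (g n i.+1) => /=.
  by rewrite in_itv/= g_itv.
have gi : g n i < g n i.+1.
  rewrite lt_neqAle g_le// andbT; apply: contraTneq lt_eps => ->.
  by rewrite subrr -leNgt ltW.
rewrite (step_cell _ ni) ?gi ?lexx// distrC ger0_norm// subr_ge0.
by apply: expV_le => //; exact: ltW.
Qed.

(** On a given path the jumps are at most L / (n+1), so the path leaves the event [jump n eps] for
    good once n is large. Dominated convergence of the indicators turns this into convergence of the
    probabilities. *)
Lemma step_expV_ucp : ucp_cvg P T (fun n => simple_value (step_expV n)) expV.
Proof.
move=> eps eps0.
have mexp t : 0 <= t <= T -> measurable_fun setT (expV t).
  move=> tT; have /andP[t0 _] := tT.
  exact: (measurable_for_fun FF t0 (expV_adapted tT)).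
have mj n : measurable (jump n eps).
  apply: bigcup_measurable => i _.
  have md : measurable_fun setT (fun w => expV (g n i.+1) w - expV (g n i) w).
    by apply: measurable_funB; apply: mexp; exact: g_itv.
  have := md measurableT `]eps, +oo[%classic (measurable_itv _).
  by rewrite setTI; congr measurable; apply/seteqP; split => w /=; rewrite in_itv/= andbT.
have -> : (fun n => P [set w | (eps%:E < running_sup T (fun t w =>
    (simple_value (step_expV n) t w - expV t w)%R) w)%E]) =
    (fun n => \int[P]_w (\1_(jump n eps) w)%:E)%E.
  by apply/funext => n; rewrite step_event// integral_indic// setIT.
rewrite [X in _ --> X](_ : _ = (\int[P]_w (cst (0 : R) w)%:E)%E); last first.
  by rewrite integral0.
apply: (@dominated_cvg_EFin _ _ _ _ _ _ (cst 1)) => //.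
- by move=> n; exact: measurable_indic.
- apply: aeW => w; apply: cvg_near_cst; have [L [L0 HL]] := expV_lipschitz w.
  exists (Num.trunc (L / eps)).+1 => // n /= Ln; rewrite indicE.
  rewrite (_ : (w \in _) = false)//; apply/negP; rewrite inE => -[i _ /=].
  apply/negP; rewrite -leNgt.
  apply: (le_trans (HL _ _ (g_ge0 n i) (g_le n (leqnSn i)) (g_leT n _))).
  apply: (@le_trans _ _ (L / n.+1%:R)).
    by rewrite ler_wpM2l.
  rewrite ler_pdivrMr// mulrC -ler_pdivrMr//.
  apply: (le_trans (ltW (truncnS_gt _))); rewrite ler_nat.
  exact: (leq_trans Ln).
- exact: finite_measure_integrable_cst.
- by move=> n w; rewrite indicE normr_nat; case: (_ \in _).
Qed.

Lemma step_integral_bound (M : R -> Omega -> R) (n : nat) (t : R) (w : Omega) (B : R) :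
  0 <= t <= T -> (forall r, 0 <= r <= T -> `|M r w - M 0 w| <= B) ->
  `|simple_integral (step_expV n) M t w| <= 2 * expV t w * B.
Proof.
move=> /andP[t0 tT] MB; rewrite /simple_integral /stopped /=.
pose c i := expV (Num.min t (g n i)) w.
pose m i := M (Num.min t (g n i)) w - M 0 w.
have tg_itv i : 0 <= Num.min t (g n i) <= T by rewrite le_min t0 g_ge0 ge_min tT.
have tg_le i j : (i <= j)%N -> Num.min t (g n i) <= Num.min t (g n j).
  by move=> ij; rewrite le_min !ge_min lexx/= (g_le n ij) orbT.
(* Once g_i >= t the stopped increment vanishes, so its coefficient may be evaluated at min(t, g_i)
   instead. The last coefficient is then at most [expV t], not [expV T], and this is what the factor
   in front of the integral in Z can cancel. *)
rewrite (eq_bigr (fun i : 'I_(sz n) => c i * (m i.+1 - m i))); last first.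
  move=> i _; rewrite /c /m; have [tg|gt] := leP t (g n i).
    rewrite (min_l (le_trans tg (g_le n (leqnSn i)))).
    by rewrite (subrr (M t w)) (subrr (M t w - M 0 w)) !(mulr0 (expV _ _)).
  by congr (_ * _); ring.
apply: (@le_trans _ _ (2 * c (sz n) * B)).
  apply: abel_bound.
  - exact: expR_ge0.
  - move=> i j ij; apply: expV_le; [|exact: tg_le|].
      by have /andP[] := tg_itv i.
    by have /andP[] := tg_itv j.
  - by rewrite /m g0 min_r// subrr.
  - by move=> i; apply: MB.
have B0 : 0 <= B by apply: le_trans (MB 0 _); rewrite ?lexx.
apply: (ler_wpM2r B0); apply: (ler_wpM2l (ler0n _ 2)); have /andP[c0 _] := tg_itv (sz n).
by apply: (expV_le _ c0 _ tT); rewrite ge_min lexx.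
Qed.

End integrand.

Lemma continuous_sum_ord {R : realType} (n : nat) (f : nat -> R -> R) :
  (forall i, continuous (f i)) -> continuous (fun t => \sum_(i < n) f i t).
Proof.
move=> cf; elim: n => [|n IH].
  under eq_fun do rewrite big_ord0; exact: cst_continuous.
under eq_fun do rewrite big_ord_recr/=.
by move=> t; apply: (@continuousD _ _ _ (fun t => \sum_(i < n) f i t)); [exact: IH|exact: cf].
Qed.

Section stochastic_integral_bound.
Context {d : measure_display} {Omega : measurableType d} {R : realType}.
Variables (P : probability Omega R) (F : R -> set (set Omega)) (T : R).
Variables (M V I : R -> Omega -> R).
Hypotheses (FF : filtration F) (T0 : 0 <= T).
Hypotheses (aM : adapted F T M) (cM : continuous_process T M).
Hypotheses (aV : adapted F T V) (cV : continuous_process T V).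
Hypothesis V_le0 : forall t w, 0 <= t <= T -> V t w <= 0.
Hypothesis IM : is_stochastic_integral P F T M (expV V) I.

Let mM t : 0 <= t <= T -> measurable_fun setT (M t).
Proof.
by move=> tT; apply: (measurable_for_fun FF _ (aM tT)); case/andP: tT.
Qed.

Let J n t w := simple_integral (step_expV T V n) M t w - I t w.

Let cJ n : continuous_process T (J n).
Proof.
have [_ cI _] := IM; apply/(continuous_process_clamp _ T0) => w.
have cstop (r : R) : 0 <= r <= T ->
    continuous (fun t => stopped (fun=> r) M (clamp T t) w : R).
  move=> /andP[r0 _].
  exact: ((continuous_process_clamp _ T0).1 (continuous_stopped T0 cM (fun=> r0)) w).
have cS : continuous (fun t => simple_integral (step_expV T V n) M (clamp T t) w).
  apply: (@continuous_sum_ord _ _ (fun i t => expV V (clamp T (gridpt n i)) w *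
    (stopped (fun=> clamp T (gridpt n i.+1)) M (clamp T t) w -
     stopped (fun=> clamp T (gridpt n i)) M (clamp T t) w))) => i t.
  apply: (@continuousM _ _ (cst (expV V (clamp T (gridpt n i)) w))
    (fun t => stopped (fun=> clamp T (gridpt n i.+1)) M (clamp T t) w -
     stopped (fun=> clamp T (gridpt n i)) M (clamp T t) w)).
    exact: cst_continuous.
  apply: (@continuousB _ _ _
    (fun t => stopped (fun=> clamp T (gridpt n i.+1)) M (clamp T t) w));
    by apply: cstop; exact: clamp_itv.
move=> t; apply: (@continuousB _ _ _
  (fun t => simple_integral (step_expV T V n) M (clamp T t) w)); first exact: cS.
exact: ((continuous_process_clamp I T0).1 cI).
Qed.

Let mJ n t : 0 <= t <= T -> measurable_fun setT (J n t).
Proof.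
move=> tT; have [aI _ _] := IM; have /andP[t0 tT'] := tT.
apply: measurable_funB; last exact: (measurable_for_fun FF t0 (aI t tT)).
apply: measurable_sum => i; apply: measurable_funM.
  have /andP[g0 _] := clamp_itv (gridpt n i) T0.
  apply: (measurable_for_fun FF g0).
  exact: (expV_adapted FF aV cV V_le0 (clamp_itv _ T0)).
have min_itv r : 0 <= clamp T r <= T -> 0 <= Num.min t (clamp T r) <= T.
  by move=> /andP[r0 rT]; rewrite le_min t0 r0 ge_min tT'.
by apply: measurable_funB; exact: (mM (min_itv _ (clamp_itv _ T0))).
Qed.

Let S w := fine (running_sup T (fun t w => M t w - M 0 w) w).

(** The bound on the step integrals is uniform in n, so one n per precision 1/(k+1) is enough. The
    event that every n fails at precision k has probability at most each P(D n k), which tends to 0;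
    the union over k is still negligible. *)
Lemma stochastic_integral_bound :
  {ae P, forall w, forall t, 0 <= t <= T -> `|I t w| <= 2 * expV V t w * S w}.
Proof.
have [_ _ ucpI] := IM.
have := ucpI (step_expV T V) (step_expV_predictable FF T0 aV cV V_le0)
  (step_expV_ucp P FF T0 aV cV V_le0) => {}ucpI.
pose D n k := [set w | k.+1%:R^-1 < fine (running_sup T (J n) w)].
have mD n k : measurable (D n k).
  have mrs := measurable_running_sup T0 (@cJ n) (@mJ n).
  have := mrs measurableT `]k.+1%:R^-1, +oo[%classic (measurable_itv _).
  by rewrite setTI; congr measurable; apply/seteqP; split => w /=; rewrite in_itv/= andbT.
have negD k : P.-negligible (\bigcap_n D n k).
  have mB : measurable (\bigcap_n D n k) by exact: bigcapT_measurable.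
  apply/(negligibleP _ mB); apply/eqP; rewrite eq_le measure_ge0 andbT.
  have k0 : (0 : R) < k.+1%:R^-1 by rewrite invr_gt0.
  have DE : (fun n => P [set w | ((k.+1%:R^-1)%:E <
      running_sup T (fun t w => (simple_integral (step_expV T V n) M t w - I t w)%R) w)%E]) =
      (fun n => P (D n k)).
    apply/funext => n; congr (P _); apply/seteqP; split => w /=;
    by rewrite -/(J n) (running_sup_fin T0 (@cJ n)) lte_fin.
  have := ucpI _ k0; rewrite DE => PD; apply: (cvge_ge _ PD).
  apply: nearW => n; apply: le_measure; rewrite ?inE//.
  by move=> w /(_ n Logic.I).
have negU := negligible_bigcup negD.
apply: negligibleS negU => w /= nH; apply: contrapT => nD; apply: nH => t tT.
apply/ler_addgt0Pr => e e0.
have [k ke] := ltr_add_invr e0; rewrite add0r in ke.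
have [n nDn] : exists n, ~ D n k w.
  apply: contrapT => H; apply: nD; exists k => // n _; apply: contrapT => Dn.
  by apply: H; exists n.
have : fine (running_sup T (J n) w) <= k.+1%:R^-1.
  by rewrite leNgt; apply/negP.
move=> /(le_trans (le_running_sup T0 (@cJ n) w tT)) Jk.
have Mb r : 0 <= r <= T -> `|M r w - M 0 w| <= S w.
  by apply: (le_running_sup T0) => //; exact: continuous_increment.
have := step_integral_bound T0 cV V_le0 n tT Mb => SB.
rewrite (_ : I t w = simple_integral (step_expV T V n) M t w - J n t w); last first.
  by rewrite /J; ring.
apply: (le_trans (ler_normB _ _)); apply: lerD => //.
exact: (le_trans Jk (ltW ke)).
Qed.

End stochastic_integral_bound.

Section convolution_bound.
Context {d : measure_display} {Omega : measurableType d} {R : realType}.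
Variables (P : probability Omega R) (F : R -> set (set Omega)) (T : R).
Variables (M V I : R -> Omega -> R).
Hypotheses (FF : filtration F) (T0 : 0 <= T).
Hypotheses (aM : adapted F T M) (cM : continuous_process T M).
Hypotheses (aV : adapted F T V) (cV : continuous_process T V).
Hypothesis V_le0 : forall t w, 0 <= t <= T -> V t w <= 0.
Hypothesis IM : is_stochastic_integral P F T M (expV V) I.

Let Z t w := expR (time_integral V t w) * I t w.
Let S w := fine (running_sup T (fun t w => M t w - M 0 w) w).

Lemma continuous_convolution : continuous_process T Z.
Proof.
have [_ cI _] := IM; apply/(continuous_process_clamp _ T0) => w.
have ti : {within `[0, T], continuous (fun t => time_integral V t w)}.
  apply: parameterized_integral_continuous => //.
  by apply: continuous_compact_integrable; [exact: segment_compact|exact: cV].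
have cti := continuous_comp_clamp T0 ti.
move=> t; apply: (@continuousM _ _ (fun t => expR (time_integral V (clamp T t) w))
  (fun t => I (clamp T t) w)); last exact: ((continuous_process_clamp I T0).1 cI).
apply: (@continuous_comp _ _ _ (fun t => time_integral V (clamp T t) w)).
  exact: cti.
exact: continuous_expR.
Qed.

Lemma measurable_convolution t : 0 <= t <= T -> measurable_fun setT (Z t).
Proof.
move=> tT; have [aI _ _] := IM; have /andP[t0 _] := tT.
apply: measurable_funM; last exact: (measurable_for_fun FF t0 (aI t tT)).
apply: measurableT_comp => //.
exact: (measurable_for_fun FF t0 (time_integral_adapted FF aV cV V_le0 tT)).
Qed.

Lemma convolution_sup_bound :
  {ae P, forall w, fine (running_sup T Z w) <= 2 * S w}.
Proof.
have := stochastic_integral_bound FF T0 aM cM aV cV V_le0 IM.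
apply: filterS => w Iw; have [c [cT -> _]] := running_sup_attained T0 continuous_convolution w.
rewrite /= /Z normrM ger0_norm ?expR_ge0//.
apply: (le_trans (ler_wpM2l (expR_ge0 _) (Iw c cT))).
rewrite /expV [X in X <= _](_ : _ = expR (time_integral V c w) *
  expR (- time_integral V c w) * (2 * S w)); last by rewrite /S; ring.
by rewrite -expRD subrr expR0 mul1r.
Qed.

End convolution_bound.

Theorem theorem2p5 (R : realType) (p : R) (hp : 0 < p) :
  exists C : R, 0 < C /\
  forall (d : measure_display) (Omega : measurableType d)
    (P : probability Omega R) (F : R -> set (set Omega)) (T : R)
    (M QM V I Z : R -> Omega -> R),
  usual_conditions P F ->
  0 < T ->
  continuous_local_martingale P F T M ->
  is_quadratic_variation P F T M QM ->
  adapted F T V ->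
  continuous_process T V ->
  (forall t w, 0 <= t <= T -> V t w <= 0) ->
  is_stochastic_integral P F T M
    (fun s w => expR (- time_integral V s w)) I ->
  (forall t w, 0 <= t <= T -> Z t w = expR (time_integral V t w) * I t w) ->
  (\int[P]_w (running_sup T Z w `^ p) <=
     C%:E * \int[P]_w ((QM T w `^ (p / 2))%R)%:E)%E.
Proof.
exists (2 `^ p * good_lambda_cst p); split; first by rewrite mulr_gt0 ?powR_gt0 ?good_lambda_cst_gt0.
move=> d Omega P F T M QM V I Z [_ FF _ _] T_gt0 [lM cM] QV aV cV V_le0 IM ZE.
have T0 := ltW T_gt0; have [aM _] := lM.
(* [Z] is prescribed on [0, T] only; [Z'] is given by the formula at all times and has the same
   running supremum. *)
pose Z' t w := expR (time_integral V t w) * I t w.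
have ZZ' w : running_sup T Z w = running_sup T Z' w.
  congr ereal_sup; apply: eq_imagel => t /=; rewrite in_itv/= => tT.
  by rewrite ZE.
have cZ' := continuous_convolution T0 cV IM.
have mZ' := measurable_running_sup T0 cZ' (measurable_convolution FF aV cV V_le0 IM).
pose S w := fine (running_sup T (fun t w => M t w - M 0 w) w).
have cN := continuous_increment T0 cM.
have mM t : 0 <= t <= T -> measurable_fun setT (M t).
  by move=> tT; apply: (measurable_for_fun FF _ (aM t tT)); case/andP: tT.
have mS : measurable_fun setT S.
  apply: measurable_running_sup => // t tT; apply: measurable_funB; apply: mM => //.
  by rewrite lexx.
have S0 w : 0 <= S w by exact: fine_running_sup_ge0.
have mpow (f : Omega -> R) : measurable_fun setT f ->
    measurable_fun setT (fun w => (f w `^ p)%:E).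
  by move=> mf; apply/measurable_EFinP; exact: (measurableT_comp (measurable_powR _)).
apply: (@le_trans _ _ (\int[P]_w (2 `^ p * S w `^ p)%:E)%E).
  under eq_integral => w _.
    rewrite ZZ' (running_sup_fin T0 cZ') poweR_EFin.
    over.
  apply: ae_ge0_le_integral => //.
  - by move=> w _; rewrite lee_fin powR_ge0.
  - exact: mpow.
  - by move=> w _; rewrite lee_fin mulr_ge0 ?powR_ge0.
  - by under eq_fun do rewrite EFinM; apply: measurable_funeM; exact: mpow.
  - have := convolution_sup_bound FF T0 aM cM aV cV V_le0 IM.
    apply: filterS => w Zw _; rewrite lee_fin -powRM//.
    by rewrite ge0_ler_powR ?(ltW hp)// nnegrE ?fine_running_sup_ge0// mulr_ge0.
under eq_integral do rewrite EFinM.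
rewrite ge0_integralZl_EFin ?powR_ge0//; last 2 first.
- by move=> w _; rewrite lee_fin powR_ge0.
- exact: mpow.
rewrite EFinM -muleA; apply: lee_wpmul2l; first by rewrite lee_fin powR_ge0.
exact: (running_sup_moment_le FF T0 hp lM cM QV).
Qed.
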